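(* Consider any $g\in\mathcal G$. There exist numerical positive constants $c_1$ and $c_2$ and a constant $c_g>0$ (only depending on $g$) such that the following holds for all $n>2k\ge c_1$ and any $\alpha\in(0,1/2)$. Assume that $$\frac k{n\,c_g}\ge\min_{t\in[\frac\alpha{2n},\frac\alpha{12}]}\Big[\overline G^{-1}\Big(\frac t2\Big)-\overline G^{-1}\Big(\frac{12t}\alpha\Big)\Big],$$ and consider $$t_0=\max\Big\{t\in\Big[\frac\alpha{2n},\frac\alpha{12}\Big]\ :\ \overline G^{-1}\Big(\frac t2\Big)-\overline G^{-1}\Big(\frac{12t}\alpha\Big)\le\frac k{n\,c_g}\Big\}.$$ For any multiple testing procedure $R$ satisfying $\mathrm{FDR}(P,R)\le\frac15$ for all $P\in\mathcal P_g$ with $n_1(P)\le k$, there exists some $P\in\mathcal P_g$ with $n_1(P)\le k$ such that $$\mathbb P_{Y\sim P}(|R(Y)\cap\mathcal H_1(P)|=0)\ge2/5,$$ $$\mathbb P_{Y\sim P}\Big[|\mathrm{BH}^*_{\alpha/2}\cap\mathcal H_1(P)|\ge\frac{2nt_0}\alpha\Big]\ge1-e^{-c_2\alpha^{-1}nt_0}.$$ In particular, $\mathbf I_g(R,k)\le1/5$ implies $\mathbf{II}_g(R,k,\alpha/2)\ge2/5-e^{-c_2\alpha^{-1}nt_0}$.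
   Context: Notation: $x\vee y=\max(x,y)$; numerical constants are absolute constants. $\mathcal G$ is the collection of probability densities on $\mathbb R$ that are symmetric (about $0$), continuous, and non-increasing on $\mathbb R_+$. For $g\in\mathcal G$, $\overline G(y)=\int_y^{+\infty}g(x)\,dx$, and $\overline G^{-1}(q)$, $q\in(0,1)$, is the inverse function of $\overline G$ (with $\overline G^{-1}(1)=\inf\{x:\overline G(x)<1\}\in[-\infty,0)$). Setting. One observes $Y=(Y_1,\dots,Y_n)$ with independent real coordinates, $Y_i\sim P_i$, and $P=\otimes_{i=1}^nP_i$. $\mathcal P_g$ is the set of all such product distributions $P$ on $\mathbb R^n$ for which there exists $\theta\in\mathbb R$ with $|\{i: P_i\text{ has density }g(\cdot-\theta)\}|>n/2$; this $\theta$ is unique and denoted $\theta(P)$. Let $\mathcal H_0(P)=\{i: P_i\text{ has density }g(\cdot-\theta(P))\}$ (true nulls), $\mathcal H_1(P)$ its complement in $\{1,\dots,n\}$, $n_1(P)=|\mathcal H_1(P)|$. A multiple testing procedure is a measurable map $R$ from the data $Y$ to subsets $R(Y)\subset\{1,\dots,n\}$. Set $$\mathrm{FDP}(P,R(Y))=\frac{|R(Y)\cap\mathcal H_0(P)|}{|R(Y)|\vee1},\quad \mathrm{FDR}(P,R)=\mathbb E_{Y\sim P}[\mathrm{FDP}(P,R(Y))],\quad \mathrm{TDP}(P,R(Y))=\frac{|R(Y)\cap\mathcal H_1(P)|}{n_1(P)\vee1}.$$ BH. For $u\in\mathbb R$ let $p_i(u)=2\overline G(|Y_i-u|)$, $T_\alpha(u)=\max\{t\in[0,1]:\sum_{i=1}^n\mathbf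 1\{p_i(u)\le t\}\ge nt/\alpha\}$ and $\mathrm{BH}_\alpha(u)=\{i: p_i(u)\le T_\alpha(u)\}$. The oracle is $\mathrm{BH}^*_\alpha=\mathrm{BH}_\alpha(\theta(P))$. Risks: $\mathbf I_g(R,k)=\sup_{P\in\mathcal P_g,\,n_1(P)\le k}\mathrm{FDR}(P,R)$ and $\mathbf{II}_g(R,k,\alpha)=\sup_{P\in\mathcal P_g,\,n_1(P)\le k}\mathbb P_{Y\sim P}\big(\mathrm{TDP}(P,R)<\mathrm{TDP}(P,\mathrm{BH}^*_\alpha)\big)$. *)

(* Defs.v *)
From HB Require Import structures.
From mathcomp Require Import all_boot all_order all_algebra.
From mathcomp Require Import all_classical all_reals all_analysis.

Set Implicit Arguments.
Unset Strict Implicit.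
Unset Printing Implicit Defensive.

Import Order.TTheory GRing.Theory Num.Theory.
Import numFieldNormedType.Exports.

Local Open Scope classical_set_scope.
Local Open Scope ring_scope.

(* Maximum of a set of reals and minimum of a set of extended reals; the value
   is a junk one when the extremum is not attained. *)
Definition set_maximum (R : realType) (A : set R) : R :=
  xget 0 [set m | A m /\ ubound A m].

Definition set_minimum (R : realType) (A : set (\bar R)) : \bar R :=
  xget +oo%E [set m | A m /\ lbound A m].

Section Model.
Context (R : realType).
Implicit Types (g : R -> R) (alpha u theta : R).

Definition sym_unimodal_density g : Prop :=
  [/\ forall x, 0 <= g x,
      (\int[lebesgue_measure]_x (g x)%:E = 1)%E,
      forall x, g (- x) = g x,
      continuous g &
      forall x y, 0 <= x -> x <= y -> g y <= g x].

Definition Gbar g (y : R) : R :=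
  Rintegral lebesgue_measure `[y, +oo[ g.

(* Inverse of [Gbar g] on ]0, 1], with values in [\bar R] since the value at 1
   is [-oo] when [g] has unbounded support.  For q in ]0, 1[ the solution x of
   [Gbar g x = q] exists and is unique; other values of q are irrelevant. *)
Definition Gbar_inv g (q : R) : \bar R :=
  if q == 1 then ereal_inf [set x%:E | x in [set x | Gbar g x < 1]]
  else (xget 0 [set x | Gbar g x = q])%:E.

Section Sample.
Context (n : nat).
Local Notation sample := (n.-tuple (measurableTypeR R)).
Implicit Types (P : probability sample R) (y : sample).
Implicit Types (rej : sample -> {set 'I_n}) (k : nat).

Definition marginal P (i : 'I_n) : set (measurableTypeR R) -> \bar R :=
  pushforward P (fun y => tnth y i).

(* [P] is the product of its marginals, i.e. the coordinates are independent;
   rectangles determine the product measure. *)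
Definition product_law P : Prop :=
  forall A : 'I_n -> set (measurableTypeR R),
    (forall i, measurable (A i)) ->
    P [set y | forall i, A i (tnth y i)] = (\prod_(i < n) marginal P i (A i))%E.

Definition has_density (mu : set (measurableTypeR R) -> \bar R) (f : R -> R) :
    Prop :=
  forall A : set (measurableTypeR R), measurable A ->
    mu A = (\int[lebesgue_measure]_(x in A) (f x)%:E)%E.

Definition nulls_at g P theta : {set 'I_n} :=
  [set i | `[< has_density (marginal P i) (fun x => g (x - theta)) >]].

Definition majority_null g P theta : Prop :=
  (n < 2 * #|nulls_at g P theta|)%N.

Definition model g : set (probability sample R) :=
  [set P | product_law P /\ exists theta, majority_null g P theta].

(* On [model g] the majority location is unique. *)
Definition location g P : R := xget 0 [set theta | majority_null g P theta].

Definition H0 g P : {set 'I_n} := nulls_at g P (location g P).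
Definition H1 g P : {set 'I_n} := ~: H0 g P.
Definition n1 g P : nat := #|H1 g P|.

Definition model_le g k : set (probability sample R) :=
  [set P | model g P /\ (n1 g P <= k)%N].

(* Measurability for the discrete sigma-algebra on [{set 'I_n}]. *)
Definition testing_procedure rej : Prop :=
  forall B : set {set 'I_n}, measurable (rej @^-1` B).

Definition FDP g P (S : {set 'I_n}) : R :=
  #|S :&: H0 g P|%:R / (maxn #|S| 1)%:R.

Definition TDP g P (S : {set 'I_n}) : R :=
  #|S :&: H1 g P|%:R / (maxn (n1 g P) 1)%:R.

Definition FDR g P rej : \bar R := 'E_P[fun y => FDP g P (rej y)].

Definition pvalue g u y (i : 'I_n) : R := 2 * Gbar g `|tnth y i - u|.

Definition BH_threshold g alpha u y : R :=
  set_maximum [set t | 0 <= t <= 1 /\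
    n%:R * t / alpha <= #|[set i | pvalue g u y i <= t]%SET|%:R].

Definition BH g alpha u y : {set 'I_n} :=
  [set i | pvalue g u y i <= BH_threshold g alpha u y].

Definition oracle_BH g P alpha y : {set 'I_n} := BH g alpha (location g P) y.

Definition risk_I g rej k : \bar R :=
  ereal_sup [set FDR g P rej | P in model_le g k].

Definition risk_II g rej k alpha : \bar R :=
  ereal_sup [set P [set y | TDP g P (rej y) < TDP g P (oracle_BH g P alpha y)]
            | P in model_le g k].

End Sample.

Definition quantile_gap g alpha (t : R) : \bar R :=
  (Gbar_inv g (t / 2) - Gbar_inv g (12 * t / alpha))%E.

Definition t_range (n : nat) alpha : set R :=
  `[alpha / (2 * n%:R), alpha / 12].

End Model.

(* Main.v *)
Require Import Defs.
From HB Require Import structures.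
From mathcomp Require Import all_boot all_order all_algebra.
From mathcomp Require Import all_classical all_reals all_analysis.
From mathcomp Require Import measurable_realfun zify ring lra.
Import Order.TTheory GRing.Theory Num.Theory.
Import numFieldNormedType.Exports.
Local Open Scope classical_set_scope.
Local Open Scope ring_scope.

(** The procedure does not know the location of the null distribution, and two
    locations can be confused.  Let [delta = k / (4 * n)] and shift [g] by the
    amount [2 * a] for which the total variation distance between [g] and its
    translate is [delta].  The probability density proportional to the maximum of
    the two is, up to normalization, [g] plus [delta] times an alternative [nu0]
    living on the right of [a], and also the translate plus [delta] times an
    alternative [nu1] living on the left of [a] ([confusable_exists]).  Hence
    independent observations from this density can be read in two ways: nulls
    centred at [0] with random labels marking the alternatives, or nulls centred
    at [2 * a] with other random labels.  The number of labels is binomial with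
    mean about [k / 4], so both readings belong to the model with at most [k]
    alternatives except with tiny probability ([few_labels], [enough_labels]).

    An observation on the right of [a] is a null in the second reading, and one
    on the left is a null in the first.  So as soon as something is rejected the
    two false discovery proportions add up to at least [1].  If both have
    expectation at most [1 / 5], then the procedure rejects nothing with
    probability at least about [3 / 5], and some typical labels retain
    probability at least [2 / 5] ([two_labelings], [no_rejection_exists]).
    Freezing these labels in the first reading gives the required law.

    For this law the oracle, which knows the location, is powerful.  With
    [c_g = 4 * g 0] the shift [2 * a] is at least [k / (n * c_g)], hence at least
    the quantile gap at [t0]: an alternative has p-value at most [t0] with
    probability at least [(12 * t0 / alpha - t0 / 2) / delta]
    ([confusable_tail]).  As there are at least a constant times [n * delta]
    alternatives, the expected number of these p-values is more than twice
    [2 * n * t0 / alpha], and an exponential Markov inequality shows that this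
    number reaches [2 * n * t0 / alpha] except with exponentially small
    probability ([power_tail]).  The Benjamini-Hochberg procedure at level
    [alpha / 2] then rejects all of them ([BH_rejects_below]).  The bound on the
    second risk combines the two events, as on both of them the oracle discovers
    an alternative and the procedure none. *)

Set Implicit Arguments.
Unset Strict Implicit.
Unset Printing Implicit Defensive.

(** * Random subsets and their tails *)

Section BernoulliSubsets.
Context (R : realType) (I : finType).
Implicit Types (p : I -> R) (B z : {set I}).

(** The law of the random subset of [I] that retains each [i] independently with
    probability [p i].  It describes both the random choice of the alternatives
    and the random set of small p-values. *)
Definition subset_weight p B : R := \prod_i (if i \in B then p i else 1 - p i).

Lemma subset_weight_ge0 p B :
  (forall i, 0 <= p i <= 1) -> 0 <= subset_weight p B.
Proof.
by move=> p01; apply: prodr_ge0 => i _; case: ifP => _; have := p01 i; lra.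
Qed.

Lemma sum_subset_weight_mul p (u v : I -> R) :
  \sum_(B : {set I}) subset_weight p B * \prod_i (if i \in B then u i else v i)
  = \prod_i (p i * u i + (1 - p i) * v i).
Proof.
rewrite bigA_distr; apply: eq_bigr => B _; rewrite -big_split /=.
by apply: eq_bigr => i _; case: ifP.
Qed.

Lemma sum_subset_weight p : \sum_(B : {set I}) subset_weight p B = 1.
Proof.
transitivity (\prod_(i : I) (p i * 1 + (1 - p i) * 1)).
  rewrite -sum_subset_weight_mul; apply: eq_bigr => B _.
  by rewrite big1 ?mulr1// => i _; case: ifP.
by apply: big1 => i _; ring.
Qed.

(** The generating function of [#|B :&: z|] is the product of the factors
    [1 + (x - 1) * p i], each at most [expR ((x - 1) * p i)]; both tail bounds
    follow by Markov's inequality, at [x = 1 / 2] and [x = 2]. *)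
Lemma subset_weight_gen p z (x : R) :
  0 <= x -> (forall i, 0 <= p i <= 1) ->
  \sum_(B : {set I}) subset_weight p B * x ^+ #|B :&: z|
    <= expR ((x - 1) * \sum_(i in z) p i).
Proof.
move=> x0 p01.
pose u i : R := if i \in z then x else 1.
have -> : \sum_(B : {set I}) subset_weight p B * x ^+ #|B :&: z|
    = \prod_i (p i * u i + (1 - p i) * 1).
  rewrite -sum_subset_weight_mul; apply: eq_bigr => B _; congr (_ * _).
  rewrite -prodr_const [LHS]big_mkcond /=; apply: eq_bigr => i _.
  by rewrite inE /u; case: (i \in B); case: (i \in z).
rewrite mulr_sumr [X in expR X]big_mkcond expR_sum.
apply: ler_prod => i _; have := p01 i; rewrite /u.
case: (i \in z) => pi01; last by rewrite expR0; lra.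
apply/andP; split; first by have := mulr_ge0 x0 (_ : 0 <= p i); lra.
by apply: le_trans (expR_ge1Dx _); lra.
Qed.

Lemma expRD1_ge2 : 2 <= expR 1 :> R.
Proof. by have := expR_ge1Dx (1 : R); lra. Qed.

Lemma expR_half_le2 : expR (2^-1) <= 2 :> R.
Proof.
have := expR_ge1Dx (- 2^-1 : R); rewrite expRN => h.
have e0 := expR_gt0 (2^-1 : R).
rewrite -[leLHS]invrK -[leRHS]invrK lef_pV2 ?posrE ?invr_gt0//; lra.
Qed.

(** The elementary bounds [2 <= expR 1] and [expR (1 / 2) <= 2] replace powers
    of [2] by exponentials in the two tail bounds. *)
Lemma subset_weight_lower_tail p z (a M : R) :
  (forall i, 0 <= p i <= 1) -> M <= \sum_(i in z) p i ->
  \sum_(B : {set I} | #|B :&: z|%:R < a) subset_weight p B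
    <= expR (a - M / 2).
Proof.
move=> p01 leM.
have pw B : 0 <= subset_weight p B by exact: subset_weight_ge0.
have h0 : (0 : R) <= 2^-1 by [].
apply: (@le_trans _ _ (\sum_(B : {set I})
    expR a * (subset_weight p B * (2^-1) ^+ #|B :&: z|))).
  rewrite big_mkcond; apply: ler_sum => B _.
  have hp : 0 <= subset_weight p B * (2^-1) ^+ #|B :&: z|.
    by rewrite mulr_ge0 ?exprn_ge0.
  case: ifP => [Ba|_]; last by rewrite mulr_ge0 ?expR_ge0.
  rewrite mulrCA ler_peMr// exprVn ler_pdivlMr ?exprn_gt0// mul1r.
  apply: (@le_trans _ _ (expR 1 ^+ #|B :&: z|)).
    by apply: lerXn2r; rewrite ?nnegrE ?expR_ge0// expRD1_ge2.
  by rewrite -expRM_natl mulr1 ler_expR ltW.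
rewrite -mulr_sumr expRD ler_pM2l ?expR_gt0//.
apply: le_trans (subset_weight_gen z h0 p01) _.
by rewrite ler_expR; lra.
Qed.

Lemma subset_weight_upper_tail p z (a M : R) :
  (forall i, 0 <= p i <= 1) -> \sum_(i in z) p i <= M ->
  \sum_(B : {set I} | a < #|B :&: z|%:R) subset_weight p B
    <= expR (M - a / 2).
Proof.
move=> p01 leM.
have pw B : 0 <= subset_weight p B by exact: subset_weight_ge0.
have h0 : (0 : R) <= 2 by [].
apply: (@le_trans _ _ (\sum_(B : {set I})
    expR (- (a / 2)) * (subset_weight p B * 2 ^+ #|B :&: z|))).
  rewrite big_mkcond; apply: ler_sum => B _.
  have hp : 0 <= subset_weight p B * 2 ^+ #|B :&: z|.
    by rewrite mulr_ge0 ?exprn_ge0.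
  case: ifP => [Ba|_]; last by rewrite mulr_ge0 ?expR_ge0.
  rewrite mulrCA ler_peMr// expRN mulrC ler_pdivlMr ?expR_gt0// mul1r.
  apply: (@le_trans _ _ (expR 2^-1 ^+ #|B :&: z|)).
    by rewrite -expRM_natl ler_expR ler_pM2r// ltW.
  by apply: lerXn2r; rewrite ?nnegrE ?expR_ge0// expR_half_le2.
rewrite -mulr_sumr addrC expRD ler_pM2l ?expR_gt0//.
apply: le_trans (subset_weight_gen z h0 p01) _.
by rewrite ler_expR; lra.
Qed.

End BernoulliSubsets.

(** * Two readings of the labels *)

Section TwoLabelings.
Context (R : realType) (I : finType).
Implicit Types (z S B : {set I}) (v : {set I} * {set I}).

(** The false discovery proportion of the rejection set [S] when [z] is the set
    of alternatives. *)
Definition false_fraction z S : R := #|S :\: z|%:R / (maxn #|S| 1)%:R.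

Lemma false_fraction_ge0 z S : 0 <= false_fraction z S.
Proof. by rewrite divr_ge0. Qed.

Lemma false_fraction_le1 z S : false_fraction z S <= 1.
Proof.
rewrite ler_pdivrMr ?ltr0n ?leq_max ?orbT// mul1r ler_nat.
by rewrite leq_max subset_leq_card// finset.subsetDl.
Qed.

Lemma false_fraction_anti z z' S : z \subset z' ->
  false_fraction z' S <= false_fraction z S.
Proof.
move=> zz'; rewrite ler_pM2r ?invr_gt0 ?ltr0n ?leq_max ?orbT//.
by rewrite ler_nat subset_leq_card// finset.setDS.
Qed.

(** If the nulls under one labelling are the alternatives under the other, every
    rejection is false for exactly one of them, so the two proportions add up
    to [1] as soon as something is rejected. *)
Lemma false_fractionC B S :
  false_fraction B S + false_fraction (~: B) S = (S != finset.set0)%:R.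
Proof.
rewrite /false_fraction -mulrDl -natrD !finset.setDE finset.setCK addnC.
rewrite -finset.setDE cardsID.
have [->|S0] := eqVneq S finset.set0; first by rewrite cards0 mul0r.
rewrite -cards_eq0 -lt0n in S0.
by rewrite (maxn_idPl _)// divff// pnatr_eq0 -lt0n.
Qed.

(** The combinatorial core of the lower bound.  A pair [v] records the rejected
    set [v.1] and a set [v.2] which splits the coordinates into two halves.
    Under [p1 z] the labels [z] lie in [v.2], under [p2 z] in its complement, and
    averaging over [z] with weight [w] makes the two laws equal.  So on average
    the false discovery proportions are at least those computed from [v.2] and
    from its complement, which sum to the indicator of a rejection: controlling
    both forces the procedure to reject rarely, hence to reject rarely for some
    typical labels. *)
Lemma two_labelings (w : {set I} -> R) (p1 p2 : {set I} -> {set I} * {set I} -> R)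
    (few good : pred {set I}) :
  (forall z, 0 <= w z) -> \sum_z w z = 1 ->
  (forall z v, 0 <= p1 z v) -> (forall z v, 0 <= p2 z v) ->
  (forall z, \sum_v p1 z v = 1) -> (forall z, \sum_v p2 z v = 1) ->
  (forall v, \sum_z w z * p1 z v = \sum_z w z * p2 z v) ->
  (forall z v, p1 z v != 0 -> z \subset v.2) ->
  (forall z v, p2 z v != 0 -> z \subset ~: v.2) ->
  (forall z, few z -> \sum_v p1 z v * false_fraction z v.1 <= 5^-1) ->
  (forall z, few z -> \sum_v p2 z v * false_fraction z v.1 <= 5^-1) ->
  \sum_(z | ~~ few z) w z <= 25^-1 ->
  \sum_(z | ~~ good z) w z <= 2 * 25^-1 ->
  exists2 z, good z & 2 / 5 <= \sum_(v | v.1 == finset.set0) p1 z v.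
Proof.
move=> w0 w1 p10 p20 p11 p21 pE sup1 sup2 fdr1 fdr2 wfew wgood.
(* Labels that are not [few] cost at most their total weight, as proportions
   are at most 1. *)
have avg (p : {set I} -> {set I} * {set I} -> R) :
    (forall z v, 0 <= p z v) -> (forall z, \sum_v p z v = 1) ->
    (forall z, few z -> \sum_v p z v * false_fraction z v.1 <= 5^-1) ->
    \sum_z w z * (\sum_v p z v * false_fraction z v.1) <= 5^-1 + 25^-1.
  move=> p0 p1_ fdr; rewrite (bigID few) /=; apply: lerD.
    apply: (@le_trans _ _ (\sum_(z | few z) w z * 5^-1)).
      by apply: ler_sum => z fz; rewrite ler_wpM2l// fdr.
    rewrite -mulr_suml ler_piMl// -w1 [leRHS](bigID few) /= lerDl.
    by apply: sumr_ge0.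
  apply: le_trans wfew; apply: ler_sum => z _; rewrite ler_piMr//.
  rewrite -(p1_ z); apply: ler_sum => v _.
  by rewrite ler_piMr// false_fraction_le1.
have le1 : \sum_v (\sum_z w z * p1 z v) * false_fraction v.2 v.1 <= 5^-1 + 25^-1.
  apply: le_trans (avg _ p10 p11 fdr1).
  under [leRHS]eq_bigr do rewrite mulr_sumr.
  rewrite exchange_big; apply: ler_sum => v _ /=; rewrite mulr_suml.
  apply: ler_sum => z _; rewrite -mulrA ler_wpM2l//.
  have [->|/sup1 zv] := eqVneq (p1 z v) 0; first by rewrite !mul0r.
  by rewrite ler_wpM2l// false_fraction_anti.
have le2 : \sum_v (\sum_z w z * p2 z v) * false_fraction (~: v.2) v.1
    <= 5^-1 + 25^-1.
  apply: le_trans (avg _ p20 p21 fdr2).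
  under [leRHS]eq_bigr do rewrite mulr_sumr.
  rewrite exchange_big; apply: ler_sum => v _ /=; rewrite mulr_suml.
  apply: ler_sum => z _; rewrite -mulrA ler_wpM2l//.
  have [->|/sup2 zv] := eqVneq (p2 z v) 0; first by rewrite !mul0r.
  by rewrite ler_wpM2l// false_fraction_anti.
have rej : \sum_(v | v.1 != finset.set0) (\sum_z w z * p1 z v) <= 2 * (5^-1 + 25^-1).
  rewrite big_mkcond mulr_natl mulr2n; apply: le_trans (lerD le1 le2).
  under [in X in _ <= _ + X]eq_bigr do rewrite -pE.
  rewrite -big_split /=; apply: ler_sum => v _.
  by rewrite -mulrDr false_fractionC; case: ifP => _; rewrite ?mulr1 ?mulr0.
have tot : \sum_v (\sum_z w z * p1 z v) = 1.
  rewrite exchange_big -w1; apply: eq_bigr => z _ /=.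
  by rewrite -mulr_sumr p11 mulr1.
have norej : 3/5 - 2 / 25 <= \sum_z w z * (\sum_(v | v.1 == finset.set0) p1 z v).
  under eq_bigr do rewrite mulr_sumr.
  rewrite exchange_big /=.
  move: tot; rewrite (bigID (fun v => v.1 == finset.set0)) /= => tot.
  by lra.
apply: contrapT => nex.
have bad z : good z -> \sum_(v | v.1 == finset.set0) p1 z v <= 2 / 5.
  move=> gz; rewrite leNgt; apply/negP => lt25; apply: nex.
  by exists z => //; exact: ltW.
have : \sum_z w z * (\sum_(v | v.1 == finset.set0) p1 z v) <= 2 / 5 + 2 * 25^-1.
  rewrite (bigID good) /=; apply: lerD.
    apply: (@le_trans _ _ (\sum_(z | good z) w z * (2 / 5))).
      by apply: ler_sum => z gz; rewrite ler_wpM2l// bad.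
    rewrite -mulr_suml ler_piMl// -w1 [leRHS](bigID good) /= lerDl.
    by apply: sumr_ge0.
  apply: le_trans wgood; apply: ler_sum => z _; rewrite ler_piMr//.
  rewrite -(p11 z) [leRHS](bigID (fun v => v.1 == finset.set0)) /= lerDl.
  exact: sumr_ge0.
move=> h; lra.
Qed.

End TwoLabelings.

(** * Laws on finite types and laws with a density *)

Section FiniteValuedMaps.
Context (R : realType) d (T : measurableType d) (P : probability T R).
Context (F : finType) (V : T -> F).
Hypothesis mV : forall v, measurable (V @^-1` [set v]).
Local Notation prob v := (fine (P (V @^-1` [set v]))).

Lemma expectation_finite (phi : F -> R) : (forall v, 0 <= phi v) ->
  ('E_P[fun y => phi (V y)] = (\sum_v phi v * prob v)%:E)%E.
Proof.
move=> phi0; rewrite unlock.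
under eq_integral => y _.
  have -> : phi (V y) = \sum_v phi v * \1_(V @^-1` [set v]) y.
    rewrite (bigD1 (V y)) //= indicE mem_set// mulr1 big1 ?addr0// => v vV.
    by rewrite indicE memNset ?mulr0// => /esym/eqP; rewrite (negbTE vV).
  rewrite -sumEFin; over.
rewrite ge0_integral_sum//; last 2 first.
- by move=> v; apply/measurable_EFinP; apply: measurable_funM.
- by move=> v y _; rewrite lee_fin mulr_ge0.
rewrite -sumEFin; apply: eq_bigr => v _.
under eq_integral do rewrite EFinM.
rewrite ge0_integralZl_EFin//; last exact/measurable_EFinP.
by rewrite integral_indic// setIT EFinM fineK// fin_num_measure.
Qed.

Lemma measurable_finite (Q : pred F) : measurable [set y | Q (V y)].
Proof.
rewrite (_ : mkset _ = \big[setU/set0]_(v | Q v) (V @^-1` [set v])).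
  by apply: bigsetU_measurable.
rewrite -bigcup_seq_cond; apply/seteqP; split => y /=.
  by move=> Qy; exists (V y) => //=; rewrite mem_index_enum Qy.
by move=> [v /= /andP[_ Qv] ->].
Qed.

Lemma probability_finite (Q : pred F) :
  P [set y | Q (V y)] = (\sum_(v | Q v) prob v)%:E.
Proof.
transitivity ('E_P[fun y => (Q (V y))%:R])%E.
  rewrite unlock -[X in P X]setIT -integral_indic//; last exact: measurable_finite.
  apply: eq_integral => y _; rewrite indicE; congr ((_ : bool)%:R)%:E.
  by apply/idP/idP; rewrite inE.
rewrite (expectation_finite (phi := fun v => (Q v)%:R))//.
congr EFin; rewrite [RHS]big_mkcond; apply: eq_bigr => v _.
by case: ifP; rewrite ?mul1r ?mul0r.
Qed.

Lemma sum_prob_fibers : \sum_v prob v = 1.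
Proof.
apply: EFin_inj; rewrite -(probability_finite predT) -(probability_setT P).
by congr (P _); apply/seteqP; split.
Qed.

End FiniteValuedMaps.

Section DensityLaw.
Context (R : realType).
Local Notation leb := (@lebesgue_measure R).

Section Construction.
Context (f : R -> R).
Hypotheses (f0 : forall x, 0 <= f x) (mf : measurable_fun setT f).
Hypothesis (f1 : (\int[leb]_x (f x)%:E = 1)%E).

Definition density_law (A : set (measurableTypeR R)) : \bar R :=
  (\int[leb]_(x in A) (f x)%:E)%E.

Let law0 : density_law set0 = 0%E.
Proof. by rewrite /density_law integral_set0. Qed.

Let law_ge0 A : (0 <= density_law A)%E.
Proof. by apply: integral_ge0 => x _; rewrite lee_fin. Qed.

Let law_sigma_additive : semi_sigma_additive density_law.
Proof.
move=> F mF tF mUF; rewrite /density_law ge0_integral_bigcup//.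
- apply: is_cvg_ereal_nneg_natsum_cond => n _ _.
  by apply: integral_ge0 => x _; rewrite lee_fin.
- by apply/measurable_EFinP; exact: measurable_funTS.
- by move=> x _; rewrite lee_fin.
Qed.

Let law_setT : density_law setT = 1%E.
Proof. exact: f1. Qed.

HB.instance Definition _ := isMeasure.Build _ _ _ density_law
  law0 law_ge0 law_sigma_additive.
HB.instance Definition _ := Measure_isProbability.Build _ _ _ density_law law_setT.

Lemma has_density_exists :
  exists p : probability (measurableTypeR R) R, has_density p f.
Proof. by exists density_law. Qed.

End Construction.

Lemma measurable_shift (c : R) :
  measurable_fun setT ((fun x => x - c) : measurableTypeR R -> measurableTypeR R).
Proof. exact: measurable_funB. Qed.

Lemma lebesgue_measure_shift (c : R) (A : set R) : measurable A ->
  pushforward leb ((fun x => x - c) : _ -> measurableTypeR R) A = leb A.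
Proof.
move=> mA; apply/esym/lebesgue_measure_unique => //=.
  exact: measurable_shift.
move=> ? _ [[a b]] _ <-; rewrite /pushforward.
have -> : (fun x => x - c) @^-1` `]a, b]%classic = `]a + c, b + c]%classic.
  by apply/seteqP; split => x /=; rewrite !in_itv /= ltrBrDr lerBlDr.
rewrite !lebesgue_measure_itv/= !lte_fin ltrD2r -!EFinD.
by rewrite opprD addrACA subrr addr0.
Qed.

(** Lebesgue measure is invariant under translations, hence so are integrals. *)
Lemma integral_shift (f : R -> R) (c : R) (A : set R) :
  measurable A -> measurable_fun setT f -> (forall x, 0 <= f x) ->
  (\int[leb]_(x in (fun x => x - c)%R @^-1` A) (f (x - c)%R)%:E =
   \int[leb]_(x in A) (f x)%:E)%E.
Proof.
move=> mA mf f0.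
have ms := measurable_shift c.
transitivity (\int[pushforward leb
    ((fun x => x - c)%R : measurableTypeR R -> measurableTypeR R)]_(x in A) (f x)%:E)%E.
  rewrite ge0_integral_pushforward//.
  - by apply/measurable_EFinP; exact: measurable_funTS.
  - by move=> x _; rewrite lee_fin.
apply: eq_measure_integral => //= B mB _.
by rewrite lebesgue_measure_shift.
Qed.

End DensityLaw.

(** * Product laws *)

Section ProductLaws.
Context (R : realType) d (T : measurableType d).

Definition rectangle n (A : 'I_n -> set T) : set (n.-tuple T) :=
  [set y | forall i, A i (tnth y i)].

Lemma measurable_rectangle n (A : 'I_n -> set T) :
  (forall i, measurable (A i)) -> measurable (rectangle A).
Proof.
move=> mA; rewrite (_ : rectangle A =
    \bigcap_(i in [set: 'I_n]) ((fun y => tnth y i) @^-1` A i)).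
  apply: fin_bigcap_measurable => // i _.
  by rewrite -[X in measurable X]setTI; exact: measurable_tnth.
by apply/seteqP; split => y /= yA i; [move=> _; exact: yA|exact: yA].
Qed.

Definition factorizes n (P : probability (n.-tuple T) R)
    (p : 'I_n -> probability T R) : Prop :=
  forall A, (forall i, measurable (A i)) ->
    P (rectangle A) = (\prod_(i < n) p i (A i))%E.

(** By induction on [n]: prepend one coordinate to the product of the others. *)
Lemma product_exists n (p : 'I_n -> probability T R) :
  exists P : probability (n.-tuple T) R, factorizes P p.
Proof.
elim: n p => [|n IHn] p.
  exists (@dirac _ (0.-tuple T) [tuple] R) => A mA; rewrite big_ord0.
  by rewrite /= diracE mem_set// => -[].
have [P' P'E] := IHn (fun i => p (lift ord0 i)).
pose c := fun x : T * n.-tuple T => [the n.+1.-tuple T of x.1 :: x.2].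
have mc : measurable_fun setT c by exact: measurable_cons.
pose mc' := isMeasurableFun.Build _ _ _ _ c mc.
pose X : {mfun (T * n.-tuple T)%type >-> n.+1.-tuple T} := HB.pack c mc'.
exists (distribution (p ord0 \x P')%E X) => A mA.
rewrite big_ord_recl -P'E// -product_measure1E//; last exact: measurable_rectangle.
suff -> : A ord0 `*` rectangle (fun i => A (lift ord0 i)) = X @^-1` rectangle A.
  by [].
apply/seteqP; split => -[x y] /=.
  move=> [xA yA] i; case: (unliftP ord0 i) => [j ->|-> //].
  by rewrite tnthS; exact: yA.
move=> xyA; split; first exact: (xyA ord0).
by move=> i; have := xyA (lift ord0 i); rewrite tnthS.
Qed.

Lemma measurable_tuple_rectangles n :
  measurable = <<s [set rectangle A | A in [set A : 'I_n -> set T |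
                      forall i, measurable (A i)]] >> :> set (set (n.-tuple T)).
Proof.
apply/seteqP; split.
  apply: smallest_sub; first exact: smallest_sigma_algebra.
  rewrite -bigcup_seq => B /= [i _ [C mC <-]].
  apply: sub_sigma_algebra => /=; exists (fun j => if j == i then C else setT).
    by move=> j /=; case: ifP.
  rewrite setTI; apply/seteqP; split => y /=.
    by move/(_ i); rewrite eqxx.
  by move=> yC j /=; case: eqP => [->|].
apply: smallest_sub; first exact: sigma_algebra_measurable.
by move=> _ [A mA <-]; exact: measurable_rectangle.
Qed.

Lemma mixture_exists d' (U : measurableType d') (J : Type) (s : seq J)
    (w : J -> R) (P : J -> probability U R) : (forall z, 0 <= w z) ->
  exists m : {measure set U -> \bar R},
    forall A, m A = (\sum_(z <- s) (w z)%:E * P z A)%E.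
Proof.
move=> w0; elim: s => [|z s [m mE]].
  by exists mzero => A; rewrite big_nil.
exists (measure_add (mscale (NngNum (w0 z)) (P z)) m) => A.
by rewrite big_cons -mE; exact: measure_addE.
Qed.

(** Two mixtures of laws that agree on rectangles agree everywhere, because the
    rectangles form a pi-system generating the sigma-algebra.  The weighted sums
    are compared as measures, whence the detour through [mixture_exists]. *)
Lemma mixture_unique n (J : finType) (w : J -> R)
    (P Q : J -> probability (n.-tuple T) R) :
  (forall z, 0 <= w z) ->
  (forall A : 'I_n -> set T, (forall i, measurable (A i)) ->
    \sum_z w z * fine (P z (rectangle A)) =
    \sum_z w z * fine (Q z (rectangle A))) ->
  forall B, measurable B ->
    \sum_z w z * fine (P z B) = \sum_z w z * fine (Q z B).
Proof.
move=> w0 PQ B mB.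
have [mP mPE] := mixture_exists (index_enum J) P w0.
have [mQ mQE] := mixture_exists (index_enum J) Q w0.
have toE (S : J -> probability (n.-tuple T) R) C : measurable C ->
    (\sum_z (w z)%:E * S z C = (\sum_z w z * fine (S z C))%:E)%E.
  move=> mC; rewrite -sumEFin; apply: eq_bigr => z _.
  by rewrite EFinM fineK// fin_num_measure.
suff : mP B = mQ B by rewrite mPE mQE !toE// => -[].
apply: (measure_unique _ (fun=> setT) (measurable_tuple_rectangles n)) => //.
- move=> _ _ [A mA <-] [A' mA' <-]; exists (fun i => A i `&` A' i).
    by move=> i; exact: measurableI.
  apply/seteqP; split => y /=.
    by move=> yAA; split => i; have [] := yAA i.
  by move=> [yA yA'] i; split; [exact: yA|exact: yA'].
- by move=> _; exists (fun=> setT) => //; apply/seteqP; split.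
- by rewrite bigcup_const.
- move=> _ [A mA <-]; have mR := measurable_rectangle mA.
  by rewrite mPE mQE !toE// PQ.
- by move=> _; rewrite mPE toE// ltry.
Qed.

Lemma rectangle_marginal n (P : probability (n.-tuple T) R)
    (p : 'I_n -> probability T R) :
  factorizes P p ->
  forall i B, measurable B -> P [set y | B (tnth y i)] = p i B.
Proof.
move=> PE i B mB.
pose A j := if j == i then B else setT.
have -> : [set y | B (tnth y i)] = rectangle A.
  apply/seteqP; split => y /=; last by move/(_ i); rewrite /A eqxx.
  by move=> yB j; rewrite /A; case: eqP => [->|].
rewrite PE => [|j]; last by rewrite /A; case: ifP.
rewrite (bigD1 i)//= /A eqxx big1 ?mule1// => j /negPf ->.
exact: probability_setT.
Qed.

(** Independence reduces events on the set of coordinates which fall in given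
    regions to the finite law [subset_weight]. *)
Lemma subset_law n (P : probability (n.-tuple T) R)
    (p : 'I_n -> probability T R) (C : 'I_n -> set T) :
  factorizes P p ->
  (forall i, measurable (C i)) ->
  forall B : {set 'I_n},
  measurable [set y : n.-tuple T | [set i | `[< C i (tnth y i) >]]%SET = B] /\
  P [set y | [set i | `[< C i (tnth y i) >]]%SET = B] =
    (subset_weight (fun i => fine (p i (C i))) B)%:E.
Proof.
move=> PE mC B; pose A i := if i \in B then C i else ~` C i.
have mA i : measurable (A i).
  by rewrite /A; case: ifP => _ //; exact: measurableC.
have -> : [set y | [set i | `[< C i (tnth y i) >]]%SET = B] = rectangle A.
  apply/seteqP; split => y /=.
    move=> yB i; rewrite /A -yB inE; case: ifPn => [/asboolP//|].
    by move/asboolPn.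
  move=> yA; apply/setP => i; rewrite inE; have := yA i; rewrite /A.
  by case: ifPn => [_ yC|_ yC]; [exact/asboolP|apply/asboolPn].
split; first exact: measurable_rectangle.
rewrite PE// /subset_weight -prodEFin; apply: eq_bigr => i _; rewrite /A.
case: ifP => _; first by rewrite fineK// fin_num_measure.
by rewrite probability_setC// EFinB fineK// fin_num_measure.
Qed.

End ProductLaws.

(** * The tail of a symmetric unimodal density *)

Section UpperTail.
Context (R : realType) (g : R -> R).
Hypothesis gd : sym_unimodal_density g.
Local Notation leb := (@lebesgue_measure R).
Local Notation Gb := (Gbar g).

Lemma density_ge0 x : 0 <= g x.
Proof. by case: gd => + _ _ _ _; exact. Qed.

Lemma density_sym x : g (- x) = g x.
Proof. by case: gd => _ _ + _ _; exact. Qed.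

Lemma density_measurable : measurable_fun setT g.
Proof. by apply: continuous_measurable_fun; case: gd. Qed.

(** Symmetry extends monotonicity on the half-line to all pairs ordered by
    absolute value. *)
Lemma density_norm (x y : R) : `|x| <= `|y| -> g y <= g x.
Proof.
have absE (t : R) : g `|t| = g t.
  by case: (ger0P t); rewrite ?density_sym.
by case: gd => _ _ _ _ gm xy; rewrite -(absE x) -(absE y) gm.
Qed.

Lemma density_le0 x : g x <= g 0.
Proof. by apply: density_norm; rewrite normr0. Qed.

Lemma shifted_density_measurable (theta : R) :
  measurable_fun setT (fun x : R => g (x - theta)).
Proof. by apply: (measurableT_comp density_measurable); exact: measurable_shift. Qed.

Lemma shifted_density_mass (A : set R) theta : measurable A ->
  (\int[leb]_(x in (fun x => x - theta)%R @^-1` A) (g (x - theta)%R)%:E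
   = \int[leb]_(x in A) (g x)%:E)%E.
Proof.
by move=> mA; apply: integral_shift => //; [exact: density_measurable|exact: density_ge0].
Qed.

Lemma shifted_law_exists theta :
  exists p : probability (measurableTypeR R) R,
    has_density p (fun x => g (x - theta)).
Proof.
apply: has_density_exists.
- by move=> x; exact: density_ge0.
- exact: shifted_density_measurable.
- rewrite -[X in integral _ X _](preimage_setT (fun x => x - theta)).
  by rewrite shifted_density_mass//; case: gd.
Qed.

Lemma shifted_law_tail theta (p : set (measurableTypeR R) -> \bar R) (x : R) :
  has_density p (fun x => g (x - theta)) -> p `[x, +oo[%classic = (Gb (x - theta))%:E.
Proof.
move=> pd; rewrite pd//.
have -> : `[x, +oo[%classic = (fun x => x - theta) @^-1` `[x - theta, +oo[.
  by apply/seteqP; split => t /=; rewrite !in_itv /= !andbT lerD2r.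
rewrite shifted_density_mass// /Gbar /Rintegral fineK//.
rewrite ge0_fin_numE; last by apply: integral_ge0 => t _; rewrite lee_fin density_ge0.
apply: (@le_lt_trans _ _ 1%E); last exact: ltry.
case: gd => _ <- _ _ _; apply: ge0_subset_integral => //.
- by apply/measurable_EFinP; exact: density_measurable.
- by move=> t _; rewrite lee_fin density_ge0.
Qed.

Lemma base_law_exists :
  exists p : probability (measurableTypeR R) R, has_density p g.
Proof.
have [p pd] := shifted_law_exists 0; exists p => A mA.
by rewrite pd//; apply: eq_integral => x _; rewrite subr0.
Qed.

Lemma base_law_tail (p : set (measurableTypeR R) -> \bar R) (x : R) :
  has_density p g -> p `[x, +oo[%classic = (Gb x)%:E.
Proof.
move=> pd; rewrite -[in RHS](subr0 x); apply: shifted_law_tail => A mA.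
by rewrite pd//; apply: eq_integral => t _; rewrite subr0.
Qed.

Lemma Gbar_increment x y : x <= y ->
  ((Gb x - Gb y)%:E = \int[leb]_(t in `[x, y[) (g t)%:E)%E.
Proof.
move=> xy; have [p pd] := base_law_exists.
rewrite -pd// EFinB -!(base_law_tail _ pd).
rewrite (@itv_bndbnd_setU _ _ (BLeft x) (BLeft y) +oo%O)//.
rewrite measureU//; last first.
  apply/seteqP; split => t //=; rewrite !in_itv /= andbT => -[/andP[_ ty]].
  by rewrite leNgt ty.
by rewrite addeK// fin_num_measure.
Qed.

Lemma Gbar_increment_le x y : x <= y -> Gb x - Gb y <= g 0 * (y - x).
Proof.
move=> xy; rewrite -lee_fin Gbar_increment//.
apply: (@le_trans _ _ (\int[leb]_(t in `[x, y[) (g 0)%:E)%E).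
  apply: ge0_le_integral => //.
  - by move=> t _; rewrite lee_fin density_ge0.
  - by apply/measurable_EFinP; apply: measurable_funTS; exact: density_measurable.
  - by move=> t _; rewrite lee_fin density_le0.
rewrite integral_cst//= lebesgue_measure_itv/= lte_fin.
case: ltP => [_|yx]; first by rewrite -EFinD -EFinM.
by rewrite mule0 lee_fin mulr_ge0 ?density_ge0// subr_ge0.
Qed.

Lemma Gbar_nonincreasing x y : x <= y -> Gb y <= Gb x.
Proof.
move=> xy; rewrite -subr_ge0 -lee_fin Gbar_increment//.
by apply: integral_ge0 => t _; rewrite lee_fin density_ge0.
Qed.

Lemma Gbar_increment_ge x y m : x <= y -> 0 <= m ->
  (forall t, x <= t < y -> m <= g t) -> m * (y - x) <= Gb x - Gb y.
Proof.
move=> xy m0 mg; rewrite -lee_fin Gbar_increment//.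
apply: (@le_trans _ _ (\int[leb]_(t in `[x, y[) m%:E)%E); last first.
  apply: ge0_le_integral => //.
  by apply/measurable_EFinP; apply: measurable_funTS; exact: density_measurable.
rewrite integral_cst//= lebesgue_measure_itv/= lte_fin.
case: ltP => [_|yx]; first by rewrite -EFinD -EFinM.
by rewrite mule0 lee_fin mulr_ge0_le0// subr_le0.
Qed.

(** A density bounded by [g 0] has a Lipschitz tail function; this gives its
    continuity, hence the existence of quantiles. *)
Lemma Gbar_lipschitz x y : `|Gb x - Gb y| <= g 0 * `|x - y|.
Proof.
wlog xy : x y / x <= y => [H|].
  have [xy|/ltW xy] := leP x y; first exact: H.
  by rewrite distrC [in leRHS]distrC H.
rewrite ger0_norm ?subr_ge0 ?Gbar_nonincreasing//.
by rewrite ler0_norm ?subr_le0// opprB Gbar_increment_le.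
Qed.

Lemma Gbar_continuous : continuous Gb.
Proof.
move=> x; apply/cvgrPdist_lt => e e0.
have d0 : 0 < e / (g 0 + 1) by rewrite divr_gt0// ltr_wpDl ?density_ge0.
near=> y.
apply: le_lt_trans (Gbar_lipschitz x y) _.
apply: (@le_lt_trans _ _ ((g 0 + 1) * `|x - y|)).
  by rewrite ler_wpM2r// lerDl.
rewrite mulrC -ltr_pdivlMr; last by rewrite ltr_wpDl ?density_ge0.
by near: y; exact: cvgr_dist_lt.
Unshelve. all: by end_near. Qed.

Lemma Gbar_opp x : Gb (- x) = 1 - Gb x.
Proof.
have [p pd] := base_law_exists.
apply: EFin_inj; rewrite EFinB -(base_law_tail x pd) -(base_law_tail (- x) pd).
rewrite -probability_setC// setCitvr !pd//.
rewrite integral_itv_bndo_bndc; last first.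
  by apply/measurable_EFinP; apply: measurable_funTS; exact: density_measurable.
rewrite (_ : `]-oo, x]%classic =
    (-%R : _ -> measurableTypeR R) @^-1` `[(- x), +oo[); last first.
  by rewrite opp_preimage_itvbndy opprK.
transitivity (\int[pushforward leb (-%R : measurableTypeR R -> measurableTypeR R)]_(
   t in `[(- x)%R, +oo[) (g t)%:E)%E.
  by apply: eq_measure_integral => A mA _; exact/esym/lebesgue_measureN.
rewrite ge0_integral_pushforward//=.
- by apply: eq_integral => t _; rewrite density_sym.
- by apply/measurable_EFinP; apply: measurable_funTS; exact: density_measurable.
- by move=> t _; rewrite lee_fin density_ge0.
Qed.

Lemma Gbar0 : Gb 0 = 2^-1.
Proof. by have := Gbar_opp 0; rewrite oppr0; lra. Qed.

Lemma Gbar_small q : 0 < q -> exists x, Gb x < q.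
Proof.
move=> q0; have [p pd] := base_law_exists.
have : p \o (fun n : nat => `[n%:R, +oo[%classic) @ \oo -->
    p (\bigcap_(n : nat) `[n%:R, +oo[%classic).
  apply: nonincreasing_cvg_mu.
  - by rewrite [X in (X < _)%E](base_law_tail 0%:R pd) ltry.
  - by [].
  - exact: bigcapT_measurable.
  - move=> m n mn; apply/subsetPset => t /=; rewrite !in_itv /= !andbT.
    by apply: le_trans; rewrite ler_nat.
have -> : \bigcap_(n : nat) `[n%:R, +oo[%classic = set0 :> set R.
  apply/seteqP; split => t //= /(_ (Num.bound `|t|) I) /=.
  rewrite in_itv /= andbT leNgt => /negP; apply.
  by apply: le_lt_trans (ler_norm t) _; exact: archi_boundP.
rewrite measure0 => /fine_cvgP[_] /cvgr0Pnorm_lt /(_ q q0) [N _ NP].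
have /= := NP N (leqnn N); rewrite (base_law_tail _ pd) /= => qN.
by exists N%:R; apply: le_lt_trans qN; exact: ler_norm.
Qed.

Lemma Gbar_surj q : 0 < q < 1 -> exists x, Gb x = q.
Proof.
move=> /andP[q0 q1].
have [b Gbb] := Gbar_small q0.
have [a Gba] : exists x, Gb x < 1 - q by apply: Gbar_small; lra.
have Gma : q < Gb (- a) by rewrite Gbar_opp; lra.
have ab : - a <= b.
  by rewrite leNgt; apply/negP => /ltW/Gbar_nonincreasing; lra.
have [//||c _ cE] := @IVT R Gb (- a) b q ab; last by exists c.
  by apply: continuous_subspaceT; exact: Gbar_continuous.
by rewrite ge_min le_max; apply/andP; split; apply/orP; [right|left]; exact: ltW.
Qed.

Lemma density0_gt0 : 0 < g 0.
Proof.
rewrite lt_neqAle density_ge0 andbT; apply/eqP => g00.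
have q01 : 0 < (4^-1 : R) < 1 by lra.
have [x Gx] := Gbar_surj q01.
have := Gbar_lipschitz 0 x; rewrite -g00 mul0r Gbar0 normr_le0 Gx => /eqP.
by lra.
Qed.

Lemma Gbar_lt_half x : 0 < x -> Gb x < 2^-1.
Proof.
move=> x0; have g0 := density0_gt0.
have cg : g t @[t --> (0 : R)] --> g 0 by case: gd => _ _ _ + _; apply.
have /cvgrPdist_lt /(_ (g 0 / 2)) := cg; rewrite divr_gt0// => /(_ isT).
move=> /nbhs_ballP[e /= e0 eP].
pose y := Num.min x (e / 2).
have y0 : 0 < y by rewrite lt_min x0 divr_gt0.
have yx : y <= x by rewrite ge_min lexx.
have ye : y <= e / 2 by rewrite ge_min lexx orbT.
apply: le_lt_trans (Gbar_nonincreasing yx) _; rewrite -Gbar0 -subr_gt0.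
apply: (@lt_le_trans _ _ (g 0 / 2 * (y - 0))).
  by rewrite subr0 !mulr_gt0// invr_gt0.
apply: Gbar_increment_ge; [exact: ltW|lra|move=> t /andP[t0 ty]].
have : ball 0 e t by rewrite -ball_normE /= sub0r normrN ger0_norm//; lra.
by move/eP => /=; rewrite ltr_norml; lra.
Qed.

(** A symmetric density which is positive near [0] has a unique median; this is
    what identifies the location parameter. *)
Lemma Gbar_half x : Gb x = 2^-1 -> x = 0.
Proof.
move=> Gx; apply/eqP; rewrite eq_le !leNgt; apply/andP; split; apply/negP => x0.
  by have := Gbar_lt_half x0; lra.
by have := @Gbar_lt_half (- x); rewrite Gbar_opp oppr_gt0 => /(_ x0); lra.
Qed.

End UpperTail.

(** * Quantiles and excess laws *)

Section Quantiles.
Context (R : realType) (g : R -> R).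
Hypothesis gd : sym_unimodal_density g.

Lemma Gbar_invE q : 0 < q < 1 ->
  exists2 x : R, Gbar_inv g q = x%:E & Gbar g x = q.
Proof.
move=> q01; rewrite /Gbar_inv ifF; last by apply/eqP; move: q01; lra.
exists (xget 0 [set x | Gbar g x = q]) => //.
by case: xgetP => // noroot; have [x /noroot] := Gbar_surj gd q01.
Qed.

Lemma Gbar_inv1_lty : (Gbar_inv g 1 < +oo)%E.
Proof.
rewrite /Gbar_inv eqxx; apply: (@le_lt_trans _ _ 0%:E); last exact: ltry.
by apply: ereal_inf_lbound; exists 0 => //=; rewrite Gbar0//; lra.
Qed.

(** At [q = 1] the quantile is an infimum and continuity is needed: a value of
    [Gbar g] below [1] at [y] would persist slightly to the left of [y]. *)
Lemma le_Gbar_inv q y : 0 < q <= 1 -> (y%:E <= Gbar_inv g q)%E -> q <= Gbar g y.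
Proof.
move=> /andP[q0]; rewrite le_eqVlt => /predU1P[->|q1]; last first.
  have [|x -> <-] := @Gbar_invE q; first by rewrite q0.
  by rewrite lee_fin; exact: Gbar_nonincreasing.
rewrite /Gbar_inv eqxx => yinf; rewrite leNgt; apply/negP => Gy.
pose e := (1 - Gbar g y) / (2 * g 0).
have g0 := density0_gt0 gd.
have e0 : 0 < e by rewrite divr_gt0 ?mulr_gt0// subr_gt0.
have : Gbar g (y - e) < 1.
  have := @Gbar_increment_le _ _ gd (y - e) y ltac:(lra).
  have -> : g 0 * (y - (y - e)) = (1 - Gbar g y) / 2.
    by rewrite /e; field; rewrite gt_eqF.
  by lra.
move=> Gye; have := le_trans yinf (ereal_inf_lbound (ex_intro2 _ _ (y - e) Gye erefl)).
by rewrite lee_fin; lra.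
Qed.

(** What a small quantile gap at [t] means without quantiles: shifting by [c]
    raises the tail probability from [t / 2] to at least [12 * t / alpha]. *)
Lemma quantile_gap_le alpha t (c : R) : 0 < alpha < 1 / 2 ->
  0 < t <= alpha / 12 -> (quantile_gap g alpha t <= c%:E)%E ->
  exists2 s, Gbar g s = t / 2 & 12 * t / alpha <= Gbar g (s - c).
Proof.
move=> /andP[a0 a1] /andP[t0 t1]; rewrite /quantile_gap.
have [|s -> Gs] := @Gbar_invE (t / 2); first by lra.
move=> gap; exists s => //.
have q01 : 0 < 12 * t / alpha <= 1.
  by rewrite divr_gt0 ?mulr_gt0//= ler_pdivrMr// mul1r; lra.
apply: le_Gbar_inv => //.
have : (Gbar_inv g (12 * t / alpha) < +oo)%E.
  case/andP: q01 => q0; rewrite le_eqVlt => /predU1P[->|q1].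
    exact: Gbar_inv1_lty.
  by have [|x ->] := @Gbar_invE (12 * t / alpha); [rewrite q0|rewrite ltry].
move: gap; case: (Gbar_inv _ _) => [r| |]//=.
by rewrite -EFinB !lee_fin; lra.
Qed.

End Quantiles.

Section ExcessLaw.
Context (R : realType).

(** The normalized excess of [f] over [h] on a region where [h <= f].  Only the
    masses matter below, so the new law is described by them. *)
Lemma excess_law_exists (f h : R -> R) (p q : probability (measurableTypeR R) R)
    (D : set (measurableTypeR R)) (delta : R) :
  measurable_fun setT f -> measurable_fun setT h ->
  has_density p f -> has_density q h -> measurable D ->
  (forall x, 0 <= h x) -> (forall x, D x -> h x <= f x) ->
  0 < delta -> fine (p D) - fine (q D) = delta ->
  exists nu : probability (measurableTypeR R) R, forall A, measurable A ->
    delta * fine (nu A) = fine (p (A `&` D)) - fine (q (A `&` D)).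
Proof.
move=> mf mh pf qh mD h0 hf d0 dE.
pose e x := \1_D x * ((f x - h x) / delta).
have e0 x : 0 <= e x.
  rewrite /e indicE; have [/set_mem xD|xD] := boolP (x \in D); last by rewrite mul0r.
  by rewrite mul1r divr_ge0 ?subr_ge0 ?hf// ltW.
have me : measurable_fun setT e.
  apply: measurable_funM; first exact: measurable_indic.
  by apply: measurable_funM => //; exact: measurable_funB.
have key A : measurable A ->
    (delta%:E * \int[lebesgue_measure]_(x in A) (e x)%:E + q (A `&` D) = p (A `&` D))%E.
  move=> mA; have mAD : measurable (A `&` D) by exact: measurableI.
  have -> : (\int[lebesgue_measure]_(x in A) (e x)%:E =
      \int[lebesgue_measure]_(x in A `&` D) (e x)%:E)%E.
    rewrite integral_mkcondr; apply: eq_integral => x _.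
    rewrite /restrict; case: ifPn => // xD.
    by rewrite /e indicE (negbTE xD) mul0r.
  rewrite pf// qh// -ge0_integralZl_EFin//; last 3 first.
  - by move=> x _; rewrite lee_fin.
  - by apply/measurable_EFinP; exact: measurable_funTS.
  - exact: ltW.
  rewrite -ge0_integralD//.
  - apply: eq_integral => x /set_mem[_ xD].
    rewrite -EFinM -EFinD /e indicE mem_set// mul1r mulrC divfK ?gt_eqF//.
    by rewrite subrK.
  - by move=> x _; rewrite -EFinM lee_fin mulr_ge0// ltW.
  - apply/measurable_EFinP; apply: measurable_funM => //.
    exact: measurable_funTS.
  - by move=> x _; rewrite lee_fin.
  - by apply/measurable_EFinP; exact: measurable_funTS.
have fin_p A : measurable A -> p (A `&` D) \is a fin_num.
  by move=> mA; rewrite fin_num_measure//; exact: measurableI.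
have fin_q A : measurable A -> q (A `&` D) \is a fin_num.
  by move=> mA; rewrite fin_num_measure//; exact: measurableI.
have keyR A : measurable A ->
    exists2 r, (\int[lebesgue_measure]_(x in A) (e x)%:E = r%:E)%E &
      delta * r = fine (p (A `&` D)) - fine (q (A `&` D)).
  move=> mA; move: (key A mA) (fin_p A mA) (fin_q A mA).
  have : (0 <= \int[lebesgue_measure]_(x in A) (e x)%:E)%E.
    by apply: integral_ge0 => x _; rewrite lee_fin.
  case: (integral _ _ _) => [r _| _|//]; last by rewrite gt0_muley ?lte_fin//;
    case: (q _) => // ?; case: (p _).
  case: (q _) => // s; case: (p _) => // t; rewrite -EFinM -EFinD => -[<-] _ _.
  by exists r => //=; rewrite addrK.
have e1 : (\int[lebesgue_measure]_x (e x)%:E = 1)%E.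
  have [r ->] := keyR _ measurableT; rewrite !setTI dE => /(canRL (mulKf _)).
  by rewrite gt_eqF// mulVf ?gt_eqF// => ->.
have [nu nuE] := has_density_exists e0 me e1.
by exists nu => A mA; rewrite nuE//; have [r ->] := keyR A mA.
Qed.

End ExcessLaw.

(** * Identification of the location *)

Section ModelMembership.
Context (R : realType) (g : R -> R) (n : nat).
Hypothesis gd : sym_unimodal_density g.
Local Notation sample := (n.-tuple (measurableTypeR R)).
Implicit Types (P : probability sample R) (z : {set 'I_n}).

(** Two majorities of coordinates intersect, and a common coordinate has two
    shifted densities; comparing the mass of a half-line with the median of [g]
    shows that the shifts coincide. *)
Lemma majority_null_unique P theta theta' :
  majority_null g P theta -> majority_null g P theta' -> theta = theta'.
Proof.
rewrite /majority_null => maj maj'.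
have [i] : exists i, i \in nulls_at g P theta :&: nulls_at g P theta'.
  apply/set0Pn; rewrite -card_gt0.
  have := cardsUI (nulls_at g P theta) (nulls_at g P theta').
  have := max_card (nulls_at g P theta :|: nulls_at g P theta').
  by rewrite card_ord => ? ?; lia.
rewrite !inE => /andP[/asboolP d1 /asboolP d2].
have := shifted_law_tail gd theta d1.
rewrite (shifted_law_tail gd theta d2) subrr Gbar0// => -[/(Gbar_half gd)].
by move/eqP; rewrite subr_eq0 => /eqP.
Qed.

Lemma location_nulls P theta z : nulls_at g P theta = ~: z -> (2 * #|z| < n)%N ->
  [/\ majority_null g P theta, location g P = theta & H1 g P = z].
Proof.
move=> nullE zn.
have maj : majority_null g P theta.
  by rewrite /majority_null nullE; have := cardsC z; rewrite card_ord; lia.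
have locE : location g P = theta.
  apply: (@majority_null_unique P) => //.
  rewrite /location; case: xgetP => [t -> //|nomaj].
  by have := nomaj theta.
by split=> //; rewrite /H1 /H0 locE nullE finset.setCK.
Qed.

Lemma factorized_nulls P (p : 'I_n -> probability (measurableTypeR R) R) theta z :
  factorizes P p ->
  (forall i, i \notin z -> has_density (p i) (fun x => g (x - theta))) ->
  (forall i, i \in z -> ~ has_density (p i) (fun x => g (x - theta))) ->
  nulls_at g P theta = ~: z.
Proof.
move=> PE dnull dalt; apply/setP => i; rewrite !inE.
have mE A : measurable A -> marginal P i A = p i A.
  by move=> mA; exact: rectangle_marginal.
have [iz|iz] := boolP (i \in z).
  apply/asboolPn => d; apply: (dalt i iz) => A mA.
  by rewrite -mE// d.
by apply/asboolP => A mA; rewrite mE// dnull.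
Qed.

Lemma factorized_product_law P (p : 'I_n -> probability (measurableTypeR R) R) :
  factorizes P p ->
  product_law P.
Proof.
move=> PE A mA; rewrite [LHS]PE//; apply: eq_bigr => i _.
by rewrite /marginal /pushforward -(rectangle_marginal PE).
Qed.

End ModelMembership.

(** * The Benjamini-Hochberg procedure *)

Section OracleBH.
Context (R : realType) (g : R -> R) (n : nat).
Hypothesis gd : sym_unimodal_density g.
Local Notation sample := (n.-tuple (measurableTypeR R)).
Implicit Types (alpha u t : R) (y : sample) (i : 'I_n).

Definition below u t y : {set 'I_n} := [set i | pvalue g u y i <= t].

Lemma below_sub u y t t' : t <= t' -> (#|below u t y| <= #|below u t' y|)%N.
Proof.
move=> tt'; apply/subset_leq_card/fintype.subsetP => i.
by rewrite !inE => /le_trans; apply.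
Qed.

Definition BH_feasible alpha u y : set R :=
  [set t | 0 <= t <= 1 /\ n%:R * t / alpha <= #|below u t y|%:R].

(** The count of small p-values is a nondecreasing function of [t], so the
    feasibility inequality passes to the supremum and the maximum defining the
    threshold exists. *)
Lemma BH_threshold_max alpha u y : 0 < alpha ->
  BH_feasible alpha u y (BH_threshold g alpha u y) /\
  ubound (BH_feasible alpha u y) (BH_threshold g alpha u y).
Proof.
move=> a0; rewrite /BH_threshold /set_maximum -/(BH_feasible alpha u y).
have ne : BH_feasible alpha u y 0.
  by split; rewrite ?lexx ?ler01// mulr0 mul0r.
have hs : has_sup (BH_feasible alpha u y).
  by split; [exists 0|exists 1 => t [/andP[]]].
case: xgetP => [t _ [] //|nomax]; exfalso.
apply: (nomax (sup (BH_feasible alpha u y))); split; last exact: sup_upper_bound.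
have s0 : 0 <= sup (BH_feasible alpha u y) by exact: sup_upper_bound.
split.
  by rewrite s0 /=; apply: ge_sup => [|t [/andP[]]//]; exists 0.
rewrite ler_pdivrMr//.
have [n0|n0] := eqVneq (n%:R : R) 0; first by rewrite n0 mul0r mulr_ge0// ltW.
have n0' : (0 : R) < n%:R by rewrite lt_neqAle eq_sym n0 ler0n.
rewrite mulrC -ler_pdivlMr//; apply: ge_sup => [|t tf]; first by exists 0.
have [_] := tf; rewrite ler_pdivrMr// ler_pdivlMr// mulrC => /le_trans; apply.
rewrite ler_wpM2r ?(ltW a0)// ler_nat below_sub//.
exact: sup_upper_bound.
Qed.

Lemma BH_reject alpha u y t : 0 < alpha -> 0 <= t <= 1 ->
  n%:R * t / alpha <= #|below u t y|%:R -> below u t y \subset BH g alpha u y.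
Proof.
move=> a0 t01 tn; apply/fintype.subsetP => i; rewrite !inE => it.
by apply: (le_trans it); apply: (BH_threshold_max u y a0).2.
Qed.

(** The threshold takes one of the values [alpha * m / n]: with [m] the number
    of p-values below the threshold [T], the level [alpha * m / n] is at least
    [T], and it is feasible.  This makes the rejection set a finite Boolean
    combination of events on single p-values, hence measurable. *)
Lemma in_BH alpha u y i : 0 < alpha <= 1 ->
  (i \in BH g alpha u y) = [exists m : 'I_n.+1,
    (m <= #|below u (alpha * m%:R / n%:R) y|)%N &&
    (i \in below u (alpha * m%:R / n%:R) y)].
Proof.
move=> /andP[a0 a1]; have n0 : (0 : R) < n%:R.
  by rewrite ltr0n (leq_ltn_trans _ (ltn_ord i)).
have [[_ feas] maxi] := BH_threshold_max u y a0.
apply/idP/existsP => [|[m /andP[mle im]]]; last first.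
  rewrite inE in im; rewrite inE; apply: (le_trans im); apply: maxi; split.
    rewrite divr_ge0 ?mulr_ge0 ?(ltW a0)//= ler_pdivrMr// mul1r.
    rewrite -[leRHS]mul1r ler_pM ?(ltW a0)// ler_nat -ltnS; exact: ltn_ord.
  rewrite mulrCA divff ?gt_eqF// mulr1 mulrC mulKf ?gt_eqF//.
  by rewrite ler_nat.
set T := BH_threshold g alpha u y in feas maxi *.
rewrite inE -/T => iT.
pose m := #|below u T y|.
have mn : (m < n.+1)%N by rewrite ltnS -[leqRHS]card_ord max_card.
have Tm : T <= alpha * m%:R / n%:R.
  by rewrite ler_pdivlMr// mulrC [leRHS]mulrC -ler_pdivrMr.
exists (Ordinal mn) => /=; rewrite inE (le_trans iT)// andbT.
exact: below_sub.
Qed.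

Lemma measurable_pvalue_le u t i : measurable [set y : sample | pvalue g u y i <= t].
Proof.
have mG : measurable_fun setT (fun y : sample => pvalue g u y i : measurableTypeR R).
  apply: measurable_funM => //.
  apply: (@measurableT_comp _ _ _ _ _ _ (Gbar g)).
    exact: (continuous_measurable_fun (Gbar_continuous gd)).
  apply: measurableT_comp => //; apply: measurable_funB => //.
  exact: measurable_tnth.
rewrite -[X in measurable X]setTI.
have -> : [set y : sample | pvalue g u y i <= t] =
    (fun y : sample => pvalue g u y i : measurableTypeR R) @^-1` `]-oo, t].
  by apply/seteqP; split => y /=; rewrite in_itv.
exact: mG.
Qed.

Lemma measurable_bool_set (f : 'I_n -> sample -> bool) :
  (forall i, measurable [set y | f i y]) -> forall B : {set 'I_n},
  measurable [set y | [set i | f i y]%SET = B].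
Proof.
move=> mf B.
have -> : [set y | [set i | f i y]%SET = B] =
    \bigcap_(i in [set: 'I_n]) (if i \in B then [set y | f i y] else ~` [set y | f i y]).
  apply/seteqP; split => y /=.
    by move=> yB i _; rewrite -yB inE; case: ifPn => // /negP.
  move=> yB; apply/setP => i; rewrite inE; have := yB i I.
  by case: ifP => _ /=; [move=> ->|move=> /negP/negPf ->].
apply: fin_bigcap_measurable => // i _; case: ifP => _ //.
exact: measurableC.
Qed.

Lemma measurable_below u t (B : {set 'I_n}) :
  measurable [set y : sample | below u t y = B].
Proof. exact: measurable_bool_set (measurable_pvalue_le u t) B. Qed.

Lemma measurable_BH alpha u (B : {set 'I_n}) : 0 < alpha <= 1 ->
  measurable [set y : sample | BH g alpha u y = B].
Proof.
move=> a01; apply: measurable_bool_set => i.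
pose c (m : 'I_n.+1) (S : {set 'I_n}) := (m <= #|S|)%N && (i \in S).
have -> : [set y : sample | pvalue g u y i <= BH_threshold g alpha u y] =
    \bigcup_(m in [set: 'I_n.+1])
      [set y | c m (below u (alpha * m%:R / n%:R) y)].
  apply/seteqP; split => y /=; have := in_BH u y i a01; rewrite inE => ->.
    by move=> /existsP[m cm]; exists m.
  by move=> [m _ cm]; apply/existsP; exists m.
apply: fin_bigcup_measurable => // m _.
by apply: measurable_finite => B'; exact: measurable_below.
Qed.

End OracleBH.

(** * Confusable locations *)

Section TwoLocations.
Context (R : realType) (g : R -> R).
Hypothesis gd : sym_unimodal_density g.
Local Notation law := (probability (measurableTypeR R) R).

(** Two null laws, at locations [0] and [2 * a], which become indistinguishable
    once they are contaminated in the same proportion [delta : 1] by [nu0] and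
    [nu1].  The alternative [nu0] lives to the right of [a] and [nu1] to its left,
    so the side of [a] on which an observation falls shows which of the two
    labellings may call it an alternative. *)
Definition confusable (delta a : R) (gam0 nu0 gam1 nu1 : law) : Prop :=
  [/\ has_density gam0 (fun x => g (x - 0)) /\
      has_density gam1 (fun x => g (x - 2 * a)),
      forall A, measurable A -> fine (gam0 A) + delta * fine (nu0 A) =
                               fine (gam1 A) + delta * fine (nu1 A),
      nu0 `]-oo, a[%classic = 0%E,
      nu1 `[a, +oo[%classic = 0%E &
      Gbar g a < 1].

(** Both mixtures are proportional to the maximum of [g] and of its translate by
    [2 * a]: [nu0] is the normalized excess of the translate over [g], on the
    right of [a], and [nu1] the reverse excess on the left.  The excess mass is
    [1 - 2 * Gbar g a], so any [delta] is reached by continuity, and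
    [g <= g 0] bounds the shift from below. *)
Lemma confusable_exists (delta : R) : 0 < delta < 1 ->
  exists a, delta <= g 0 * (2 * a) /\
  exists gam0 nu0 gam1 nu1, confusable delta a gam0 nu0 gam1 nu1.
Proof.
move=> /andP[d0 d1].
have [|a Ga] := @Gbar_surj _ _ gd ((1 - delta) / 2); first by lra.
have a0 : 0 <= a.
  rewrite leNgt; apply/negP => /ltW /(Gbar_nonincreasing gd).
  by rewrite Gbar0//; lra.
exists a; split.
  by have := Gbar_increment_le gd a0; rewrite Gbar0// Ga; lra.
have [gam0 d0E] := shifted_law_exists gd 0.
have [gam1 d1E] := shifted_law_exists gd (2 * a).
pose D : set (measurableTypeR R) := `[a, +oo[%classic.
have mD : measurable D by exact: measurable_itv.
have DC : ~` D = `]-oo, a[%classic by rewrite /D setCitvr.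
have g0D : fine (gam0 D) = Gbar g a.
  by rewrite (shifted_law_tail gd a d0E) subr0.
have g1D : fine (gam1 D) = 1 - Gbar g a.
  rewrite (shifted_law_tail gd a d1E) /= -(Gbar_opp gd); congr (Gbar g _).
  by lra.
have fineC (p : law) : fine (p (~` D)) = 1 - fine (p D).
  by rewrite probability_setC// -[p D]fineK ?fin_num_measure.
have split_law (p : law) A : measurable A ->
    fine (p A) = fine (p (A `&` D)) + fine (p (A `&` ~` D)).
  move=> mA; rewrite -fineD ?fin_num_measure//; try exact: measurableI.
    congr fine; rewrite -measureU//; last 3 first.
    - exact: measurableI.
    - by apply: measurableI => //; exact: measurableC.
    - by rewrite setIACA setICr setI0.
    by rewrite -setIUr setUv setIT.
  by apply: measurableI => //; exact: measurableC.
have m0 := shifted_density_measurable gd 0.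
have m1 := shifted_density_measurable gd (2 * a).
have [nu0 nu0E] : exists nu : law, forall A, measurable A ->
    delta * fine (nu A) = fine (gam1 (A `&` D)) - fine (gam0 (A `&` D)).
  apply: (excess_law_exists m1 m0 d1E d0E mD) => //.
  - by move=> x; exact: density_ge0.
  - move=> x; rewrite /D /= in_itv /= andbT => ax; apply: density_norm => //.
    by rewrite subr0 ler_norml (ger0_norm (le_trans a0 ax)); lra.
  - by rewrite g0D g1D Ga; lra.
have [nu1 nu1E] : exists nu : law, forall A, measurable A ->
    delta * fine (nu A) = fine (gam0 (A `&` ~` D)) - fine (gam1 (A `&` ~` D)).
  apply: (excess_law_exists m0 m1 d0E d1E) => //.
  - exact: measurableC.
  - by move=> x; exact: density_ge0.
  - move=> x; rewrite DC /= in_itv /= => ax; apply: density_norm => //.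
    rewrite subr0 ler_norml; case: (ler0P (x - 2 * a)); lra.
  - by rewrite !fineC g0D g1D Ga; lra.
have null (nu : law) A : measurable A -> delta * fine (nu A) = 0 -> nu A = 0%E.
  move=> mA /eqP; rewrite mulf_eq0 gt_eqF//= => /eqP nu0A.
  by rewrite -[LHS]fineK ?nu0A// fin_num_measure.
exists gam0, nu0, gam1, nu1; split => //.
- move=> A mA; rewrite nu0E// nu1E// (split_law gam0 A)// (split_law gam1 A)//.
  by lra.
- by rewrite -DC; apply: null; [exact: measurableC|
    rewrite nu0E ?setICl ?measure0 ?subrr//; exact: measurableC].
- by apply: null => //; rewrite nu1E// setICr !measure0 subrr.
- by rewrite Ga; lra.
Qed.

Section Confusable.
Context (delta a : R) (gam0 nu0 gam1 nu1 : law).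
Hypothesis conf : confusable delta a gam0 nu0 gam1 nu1.

Lemma confusable_alt0 : ~ has_density nu0 (fun x => g (x - 0)).
Proof.
have [_ _ nu00 _ Ga] := conf.
move=> /(shifted_law_tail gd a); rewrite -setCitvl probability_setC// nu00.
by rewrite sube0 subr0 => -[]; lra.
Qed.

Lemma confusable_alt1 : ~ has_density nu1 (fun x => g (x - 2 * a)).
Proof.
have [_ _ _ nu10 Ga] := conf.
move=> /(shifted_law_tail gd a); rewrite nu10 => -[].
by rewrite (_ : a - 2 * a = - a) ?Gbar_opp//; lra.
Qed.

(** Whatever [s], the alternative to [gam0] puts at least the excess of
    [gam1] over [gam0] on [[s, +oo[], as [nu1] is nonnegative. *)
Lemma confusable_tail (s : R) : 0 <= delta ->
  Gbar g (s - 2 * a) - Gbar g s <= delta * fine (nu0 `[s, +oo[%classic).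
Proof.
have [[d0E d1E] mixE _ _ _] := conf => d0.
have mA : measurable (`[s, +oo[%classic : set (measurableTypeR R)) by [].
have := mixE _ mA; rewrite (shifted_law_tail gd s d0E) (shifted_law_tail gd s d1E).
rewrite subr0 /= => E.
have : 0 <= delta * fine (nu1 `[s, +oo[%classic) by rewrite mulr_ge0// fine_ge0.
by lra.
Qed.

End Confusable.
End TwoLocations.

(** * Procedures that control the false discovery rate stay silent *)

Section LabelledLaws.
Context (R : realType) (n : nat).
Local Notation sample := (n.-tuple (measurableTypeR R)).
Local Notation law := (probability (measurableTypeR R) R).
Implicit Types (gam nu : law) (z B : {set 'I_n}).

Definition labelled gam nu z (i : 'I_n) : law := if i \in z then nu else gam.

Lemma labelled_exists gam nu : exists P : {set 'I_n} -> probability sample R,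
  forall z, factorizes (P z) (labelled gam nu z).
Proof.
by have [P PE] := choice (fun z => product_exists (labelled gam nu z)); exists P.
Qed.

(** Random labels turn the product of the labelled laws into the product of the
    mixtures of [nu] and [gam]. *)
Lemma labelled_rectangle gam nu (P : {set 'I_n} -> probability sample R)
    (A : 'I_n -> set (measurableTypeR R)) (p : R) :
  (forall z, factorizes (P z) (labelled gam nu z)) ->
  (forall i, measurable (A i)) ->
  \sum_z subset_weight (fun=> p) z * fine (P z (rectangle A)) =
  \prod_i (p * fine (nu (A i)) + (1 - p) * fine (gam (A i))).
Proof.
move=> PE mA; rewrite -sum_subset_weight_mul; apply: eq_bigr => z _.
rewrite PE//; congr (_ * _).
transitivity (fine (\prod_i (fine (labelled gam nu z i (A i)))%:E)%E).
  by congr fine; apply: eq_bigr => i _; rewrite fineK// fin_num_measure.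
by rewrite prodEFin /=; apply: eq_bigr => i _; rewrite /labelled; case: ifP.
Qed.

Lemma labelled_support gam nu (P : probability sample R)
    (C : set (measurableTypeR R)) z (E : set sample) :
  factorizes P (labelled gam nu z) -> measurable C -> measurable E ->
  nu C = 0%E -> forall i, i \in z -> E `<=` [set y | C (tnth y i)] ->
  P E = 0%E.
Proof.
move=> PE mC mE nuC i iz EC; apply/eqP; rewrite eq_le measure_ge0 andbT.
apply: le_trans (le_measure P _ _ EC) _; rewrite ?inE//.
  by rewrite -[X in measurable X]setTI; exact: measurable_tnth.
by rewrite [leLHS](rectangle_marginal PE i mC) /labelled iz nuC.
Qed.

Lemma labelled_model g theta gam nu (P : probability sample R) z :
  sym_unimodal_density g ->
  factorizes P (labelled gam nu z) ->
  has_density gam (fun x => g (x - theta)) ->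
  ~ has_density nu (fun x => g (x - theta)) -> (2 * #|z| < n)%N ->
  [/\ model g P, location g P = theta & H1 g P = z].
Proof.
move=> gd PE dgam dnu zn.
have nullE : nulls_at g P theta = ~: z.
  apply: (factorized_nulls PE) => i; rewrite /labelled.
    by move/negPf ->.
  by move=> ->.
have [maj locE H1E] := location_nulls gd nullE zn; split=> //.
by split; [exact: factorized_product_law PE|exists theta].
Qed.

Lemma FDP_false_fraction g (P : probability sample R) S :
  FDP g P S = false_fraction R (H1 g P) S.
Proof. by rewrite /FDP /false_fraction finset.setDE /H1 finset.setCK. Qed.

End LabelledLaws.

Section Indistinguishability.
Context (R : realType) (g : R -> R) (n k : nat).
Hypothesis gd : sym_unimodal_density g.
Local Notation sample := (n.-tuple (measurableTypeR R)).
Local Notation law := (probability (measurableTypeR R) R).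

(** Control of the false discovery rate around both locations of a confusable
    pair forces a procedure to stay silent under some typical labelling: this
    instantiates [two_labelings] with the pair formed by the rejected set and
    the set of observations on the right of [a]. *)
Lemma no_rejection_exists (delta a : R) (gam0 nu0 gam1 nu1 : law)
    (rej : sample -> {set 'I_n}) (few good : pred {set 'I_n}) :
  0 < delta -> confusable g delta a gam0 nu0 gam1 nu1 ->
  testing_procedure rej ->
  (forall P, model_le g k P -> (FDR g P rej <= (1 / 5)%:E)%E) ->
  (2 * k < n)%N -> (forall z, few z = (#|z| <= k)%N) ->
  let w := subset_weight (fun _ : 'I_n => delta / (1 + delta)) in
  \sum_(z | ~~ few z) w z <= 25^-1 -> \sum_(z | ~~ good z) w z <= 2 * 25^-1 ->
  exists z (P : probability sample R),
    [/\ good z, factorizes P (labelled gam0 nu0 z) &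
        ((2 / 5)%:E <= P [set y | rej y = finset.set0])%E].
Proof.
move=> d0 conf mrej fdr kn fewE w wfew wgood.
have [[d0E d1E] mixE nu00 nu10 Ga] := conf.
have [P0 P0E] := labelled_exists n gam0 nu0.
have [P1 P1E] := labelled_exists n gam1 nu1.
pose C (i : 'I_n) : set (measurableTypeR R) := `[a, +oo[%classic.
have mC i : measurable (C i) by exact: measurable_itv.
pose right (y : sample) : {set 'I_n} := [set i | `[< C i (tnth y i) >]]%SET.
pose V (y : sample) := (rej y, right y).
have mV v : measurable (V @^-1` [set v]).
  have -> : V @^-1` [set v] = rej @^-1` [set v.1] `&` [set y | right y = v.2].
    apply/seteqP; split => y /=; first by move=> <-.
    by case: v => v1 v2 /= [<- <-].
  by apply: measurableI; [exact: mrej|exact: (subset_law (P0E finset.set0) mC v.2).1].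
have w0 z : 0 <= w z.
  apply: subset_weight_ge0 => _; rewrite divr_ge0/= ?addr_ge0 ?(ltW d0)//.
  by rewrite ler_pdivrMr ?addr_gt0// mul1r lerDr.
have mix v : \sum_z w z * fine (P0 z (V @^-1` [set v])) =
             \sum_z w z * fine (P1 z (V @^-1` [set v])).
  apply: mixture_unique => // A mA.
  rewrite (labelled_rectangle _ P0E)// (labelled_rectangle _ P1E)//.
  apply: eq_bigr => i _; have := mixE _ (mA i).
    (* With rate [delta / (1 + delta)] the two mixtures agree on each coordinate. *)
have -> : 1 - delta / (1 + delta) = (1 + delta)^-1.
    by field; rewrite gt_eqF ?addr_gt0.
  rewrite ![delta / _]mulrC -!mulrA -!mulrDr => E; congr (_ * _).
  by rewrite addrC E addrC.
pose p0 z v := fine (P0 z (V @^-1` [set v])).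
pose p1 z v := fine (P1 z (V @^-1` [set v])).
have fdrE (P : probability sample R) z theta (gam nu : law) : few z ->
    factorizes P (labelled gam nu z) ->
    has_density gam (fun x => g (x - theta)) ->
    ~ has_density nu (fun x => g (x - theta)) ->
    \sum_v fine (P (V @^-1` [set v])) * false_fraction R z v.1 <= 5^-1 :> R.
  rewrite fewE => zk PE dgam dnu.
  have zn : (2 * #|z| < n)%N by apply: leq_ltn_trans kn; rewrite leq_mul2l.
  have [inP _ H1E] := labelled_model gd PE dgam dnu zn.
  have := fdr P; rewrite /model_le /= /n1 H1E => /(_ (conj inP zk)).
  rewrite /FDR; under eq_fun do rewrite FDP_false_fraction H1E.
  rewrite (expectation_finite (V := V) P mV (phi := fun v => false_fraction R z v.1)).
    rewrite lee_fin mul1r; apply: le_trans.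
    by apply: ler_sum => v _; rewrite mulrC.
  by move=> v; exact: false_fraction_ge0.
have supp0 z v : p0 z v != 0 -> z \subset v.2.
  apply: contraNT => /fintype.subsetPn[i iz iv].
  rewrite /p0 (labelled_support (P0E z) (measurable_itv `]-oo, a[) (mV v) nu00 iz)//.
  move=> y /= yv; move: iv; rewrite -yv inE => /asboolPn.
  by rewrite /C /= !in_itv /= andbT => /negP; rewrite -ltNge.
have supp1 z v : p1 z v != 0 -> z \subset ~: v.2.
  apply: contraNT => /fintype.subsetPn[i iz iv].
  rewrite /p1 (labelled_support (P1E z) (measurable_itv `[a, +oo[) (mV v) nu10 iz)//.
  by move=> y /= yv; move: iv; rewrite -yv !inE negbK => /asboolP.
have [] := @two_labelings R 'I_n w p0 p1 few good w0 (sum_subset_weight _) _ _ _ _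
  mix supp0 supp1 _ _ wfew wgood.
- by move=> z v; exact: fine_ge0.
- by move=> z v; exact: fine_ge0.
- by move=> z; exact: sum_prob_fibers.
- by move=> z; exact: sum_prob_fibers.
- by move=> z fz; exact: fdrE (P0E z) d0E (confusable_alt0 gd conf).
- by move=> z fz; exact: fdrE (P1E z) d1E (confusable_alt1 gd conf).
move=> z gz zP; exists z, (P0 z); split => //.
rewrite (_ : [set y | rej y = finset.set0] = [set y | (V y).1 == finset.set0]).
  by rewrite (probability_finite (V := V) _ mV (fun v => v.1 == finset.set0)).
by apply/seteqP; split => y /= /eqP.
Qed.

End Indistinguishability.

(** * Power of the oracle *)

Section OraclePower.
Context (R : realType) (g : R -> R) (n : nat).
Hypothesis gd : sym_unimodal_density g.
Local Notation sample := (n.-tuple (measurableTypeR R)).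
Local Notation law := (probability (measurableTypeR R) R).

Definition small_pvalue (t : R) : set (measurableTypeR R) :=
  [set x | 2 * Gbar g `|x - 0| <= t].

Lemma measurable_small_pvalue t : measurable (small_pvalue t).
Proof.
have mG : measurable_fun setT
    (fun x : measurableTypeR R => 2 * Gbar g `|x - 0| : measurableTypeR R).
  apply: measurable_funM => //.
  apply: (@measurableT_comp _ _ _ _ _ _ (Gbar g)).
    exact: (continuous_measurable_fun (Gbar_continuous gd)).
  by apply: measurableT_comp => //; exact: measurable_funB.
rewrite -[X in measurable X]setTI.
have -> : small_pvalue t =
    (fun x : measurableTypeR R => 2 * Gbar g `|x - 0| : measurableTypeR R)
      @^-1` `]-oo, t].
  by apply/seteqP; split => y /=; rewrite in_itv.
exact: mG.
Qed.

Lemma small_pvalue_tail (nu : law) (s t : R) : 2 * Gbar g s <= t ->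
  fine (nu `[s, +oo[%classic) <= fine (nu (small_pvalue t)).
Proof.
move=> st; apply: fine_le; rewrite ?fin_num_measure//.
  exact: measurable_small_pvalue.
apply: le_measure; rewrite ?inE//; first exact: measurable_small_pvalue.
move=> x /=; rewrite in_itv /= andbT => sx; rewrite /small_pvalue /= subr0.
apply: le_trans st; rewrite ler_pM2l//; apply: (Gbar_nonincreasing gd).
exact: le_trans (ler_norm x).
Qed.

(** The number of alternatives with a small p-value is a sum of [#|z|]
    independent indicators of mean at least [q]. *)
Lemma power_tail (gam nu : law) (P : probability sample R) (z : {set 'I_n})
    (t q r : R) :
  factorizes P (labelled gam nu z) -> q <= fine (nu (small_pvalue t)) ->
  ((1 - expR (r - #|z|%:R * q / 2))%:E <=
   P [set y | (r <= #|below g 0 t y :&: z|%:R)%R])%E.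
Proof.
move=> PE qnu.
pose p i := fine (labelled gam nu z i (small_pvalue t)).
have mC (i : 'I_n) := measurable_small_pvalue t.
have belowE y : below g 0 t y = [set i | `[< small_pvalue t (tnth y i) >]]%SET.
  by apply/setP => i; rewrite !inE; apply/idP/asboolP.
have Bprob B : P [set y | below g 0 t y = B] = (subset_weight p B)%:E.
  by rewrite -(subset_law PE mC B).2; congr (P _); apply/seteqP; split => y /=;
    rewrite belowE.
have mB := measurable_below gd 0 t.
have p01 i : 0 <= p i <= 1.
  rewrite fine_ge0//= -lee_fin fineK ?fin_num_measure//; last exact: mC.
  by apply: probability_le1; exact: mC.
rewrite (probability_finite P (mB n) (fun B => r <= #|B :&: z|%:R)).
under eq_bigr do rewrite [P _]Bprob /=.
rewrite lee_fin lerBlDr -[leLHS](sum_subset_weight p).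
rewrite (bigID (fun B => r <= #|B :&: z|%:R)) /= lerD2l.
under eq_bigl do rewrite -ltNge.
apply: subset_weight_lower_tail => //.
rewrite mulr_natl -sumr_const; apply: ler_sum => i iz.
by rewrite /p /labelled iz.
Qed.

(** If enough alternatives have p-value at most [t] for the level [t] to be
    feasible, the procedure rejects all of them. *)
Lemma BH_rejects_below alpha t (P : probability sample R) (z : {set 'I_n})
    (e : R) :
  0 < alpha <= 1 -> 0 <= t <= 1 -> location g P = 0 -> H1 g P = z ->
  (e%:E <= P [set y | (n%:R * t / alpha <= #|below g 0 t y :&: z|%:R)%R])%E ->
  (e%:E <= P [set y | (n%:R * t / alpha <= #|oracle_BH g P alpha y :&: H1 g P|%:R)%R])%E.
Proof.
move=> a01 t01 locE H1E /le_trans; apply; rewrite /oracle_BH locE H1E.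
apply: le_measure; rewrite ?inE.
- exact: (measurable_finite (fun B => measurable_below gd 0 t B)
    (fun B => n%:R * t / alpha <= #|B :&: z|%:R)).
- exact: (measurable_finite (fun B => measurable_BH gd 0 B a01)
    (fun B => n%:R * t / alpha <= #|B :&: z|%:R)).
move=> y /= big; apply: (le_trans big); rewrite ler_nat.
apply: subset_leq_card; apply: finset.setSI; apply: BH_reject => //.
  by case/andP: a01.
apply: (le_trans big); rewrite ler_nat; apply: subset_leq_card.
exact: subsetIl.
Qed.

End OraclePower.

(** * The least favorable law *)

Section LabelCount.
Context (R : realType) (n k : nat).
Hypotheses (kn : (2 * k < n)%N) (k_large : (5000 <= k)%N).

(** [label_excess] is the excess mass chosen in [confusable_exists], and
    [label_rate] the resulting proportion of alternatives.  The expected number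
    of alternatives is then about [k / 4], so that it exceeds [k] with tiny
    probability. *)
Definition label_excess : R := k%:R / (4 * n%:R).
Definition label_rate : R := label_excess / (1 + label_excess).
Local Notation delta := label_excess.
Local Notation rate := label_rate.
Local Notation w := (subset_weight (fun _ : 'I_n => rate)).

Lemma sample_size_gt0 : (0 : R) < n%:R.
Proof. by rewrite ltr0n (leq_ltn_trans _ kn). Qed.

Lemma label_excessM : n%:R * delta = k%:R / 4.
Proof. by rewrite /label_excess; field; rewrite gt_eqF// sample_size_gt0. Qed.

Lemma label_excess_bounds : 0 < delta < 8^-1.
Proof.
have n0 := sample_size_gt0; apply/andP; split.
  by rewrite divr_gt0 ?mulr_gt0// ltr0n; lia.
rewrite ltr_pdivrMr ?mulr_gt0//.
have : (2 * k)%:R < n%:R :> R by rewrite ltr_nat.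
by rewrite natrM; lra.
Qed.

Lemma label_rateM : (8 / 9) * (n%:R * delta) <= n%:R * rate <= n%:R * delta.
Proof.
have /andP[d0 d1] := label_excess_bounds.
have nd0 : 0 <= n%:R * delta by rewrite mulr_ge0// ltW.
rewrite /rate mulrA; apply/andP; split; last first.
  by rewrite ler_pdivrMr; [rewrite ler_peMr//; lra|lra].
rewrite ler_pdivlMr; last by lra.
rewrite mulrAC -[leRHS]mul1r; apply: ler_wpM2r => //; lra.
Qed.

Lemma label_rate01 : 0 <= rate <= 1.
Proof.
have /andP[d0 d1] := label_excess_bounds.
rewrite /rate; apply/andP; split; first by rewrite divr_ge0; lra.
by rewrite ler_pdivrMr; lra.
Qed.

Lemma expRN_le (x : R) : 0 <= x -> expR (- x) <= (1 + x)^-1.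
Proof.
move=> x0; rewrite expRN lef_pV2 ?posrE ?expR_gt0//; last by lra.
exact: expR_ge1Dx.
Qed.

Lemma expRN_le_25 (x : R) : 24 <= x -> expR (- x) <= 25^-1.
Proof.
move=> x24; apply: (le_trans (expRN_le _)); first by lra.
by rewrite lef_pV2 ?posrE; lra.
Qed.

Lemma sum_label_rate : \sum_(i in [set: 'I_n]%SET) rate = n%:R * rate.
Proof.
by rewrite sumr_const cardsT card_ord mulr_natl.
Qed.

Lemma few_labels : \sum_(z : {set 'I_n} | ~~ (#|z| <= k)%N) w z <= 25^-1.
Proof.
have kR : (5000 : R) <= k%:R by rewrite ler_nat.
have /andP[_ nr] := label_rateM; have nd := label_excessM.
apply: (@le_trans _ _ (expR (n%:R * rate - k%:R / 2))).
  rewrite (eq_bigl (fun z : {set 'I_n} => k%:R < #|z :&: finset.setT|%:R :> R)).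
    2: by move=> z; rewrite finset.setIT ltr_nat ltnNge.
  apply: subset_weight_upper_tail => [_|]; first exact: label_rate01.
  by rewrite sum_label_rate.
apply: (@le_trans _ _ (expR (- 24))); first by rewrite ler_expR; lra.
exact: expRN_le_25.
Qed.

Lemma enough_labels : \sum_(z : {set 'I_n} |
  ~~ ((2 / 5 * (n%:R * rate) <= #|z|%:R) && (#|z| <= k)%N)) w z <= 2 * 25^-1.
Proof.
have kR : (5000 : R) <= k%:R by rewrite ler_nat.
have /andP[nr _] := label_rateM; have nd := label_excessM.
have low : \sum_(z : {set 'I_n} | ~~ (2 / 5 * (n%:R * rate) <= #|z|%:R)) w z
    <= 25^-1.
  apply: (@le_trans _ _ (expR (2 / 5 * (n%:R * rate) - n%:R * rate / 2))).
    rewrite (eq_bigl (fun z : {set 'I_n} =>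
        #|z :&: finset.setT|%:R < 2 / 5 * (n%:R * rate))).
      2: by move=> z; rewrite finset.setIT ltNge.
    apply: subset_weight_lower_tail => [_|]; first exact: label_rate01.
    by rewrite sum_label_rate.
  apply: (@le_trans _ _ (expR (- 24))); first by rewrite ler_expR; lra.
  exact: expRN_le_25.
apply: (@le_trans _ _ (25^-1 + 25^-1)); last by lra.
apply: le_trans (lerD low few_labels).
rewrite [leLHS]big_mkcond [X in _ <= X + _]big_mkcond [X in _ <= _ + X]big_mkcond.
rewrite -big_split /=.
apply: ler_sum => z _.
have w0 : 0 <= w z by apply: subset_weight_ge0 => _; exact: label_rate01.
by case: (2 / 5 * _ <= _); case: (_ <= k)%N => /=; lra.
Qed.

End LabelCount.

Section LeastFavorable.
Context (R : realType).

(** The law is the one found in [no_rejection_exists].  The excess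
    [delta = k / (4 * n)] corresponds to a shift of at least
    [k / (n * (4 * g 0))], which covers the quantile gap at [t].  Hence [nu0]
    gives to the p-values at most [t] a mass at least
    [(12 * t / alpha - t / 2) / delta], and the [#|z|] alternatives produce on
    average more than [4 * (n * t / alpha)] such p-values, twice the number
    required.  The level [t = 0] is allowed because the power claim is then void;
    it is the value of [set_maximum] on a set without maximum. *)
Lemma least_favorable (g : R -> R) (n k : nat) (alpha t : R)
    (rej : n.-tuple (measurableTypeR R) -> {set 'I_n}) :
  sym_unimodal_density g -> (2 * k < n)%N -> (5000 <= k)%N ->
  0 < alpha < 1 / 2 ->
  (t != 0 -> 0 < t <= alpha / 12 /\
     (quantile_gap g alpha t <= (k%:R / (n%:R * (4 * g 0)))%:E)%E) ->
  testing_procedure rej ->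
  (forall P : probability (n.-tuple (measurableTypeR R)) R,
     model_le g k P -> (FDR g P rej <= (1 / 5)%:E)%E) ->
  exists P : probability (n.-tuple (measurableTypeR R)) R,
    [/\ model_le g k P,
        ((2 / 5)%:E <= P [set y | #|rej y :&: H1 g P| = 0%N])%E &
        ((1 - expR (- (20^-1 * alpha^-1 * n%:R * t)))%:E <=
          P [set y | (2 * n%:R * t / alpha <=
                      #|oracle_BH g P (alpha / 2) y :&: H1 g P|%:R)%R])%E].
Proof.
move=> gd kn k_large /andP[a0 a1] tP mrej fdr.
have /andP[d0 d1] := label_excess_bounds R kn k_large.
have /andP[nr _] := label_rateM R kn k_large.
have nd := label_excessM R kn.
have n0 := sample_size_gt0 R kn.
set delta := label_excess R n k in d0 d1 nr nd.
have [a [da [gam0 [nu0 [gam1 [nu1 conf]]]]]] :=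
  confusable_exists gd (ltac:(lra) : 0 < delta < 1).
have [z [P [/andP[zlow zk] PE Prej]]] := no_rejection_exists gd d0 conf mrej fdr
  kn (fun z => erefl) (few_labels R kn k_large) (enough_labels R kn k_large).
have [[d0E d1E] _ _ _ _] := conf.
have zn : (2 * #|z| < n)%N by apply: leq_ltn_trans kn; rewrite leq_mul2l.
have [inP locE H1E] := labelled_model gd PE d0E (confusable_alt0 gd conf) zn.
have mset (B : pred {set 'I_n}) : measurable [set y | B (rej y)].
  by apply: measurable_finite => S; exact: mrej.
exists P; split => //.
- by split=> //; rewrite /n1 H1E.
- apply: (le_trans Prej); apply: le_measure; rewrite ?inE.
  + by have := mset (pred1 finset.set0); congr measurable;
      apply/seteqP; split => y /= /eqP.
  + by have := mset (fun S => #|S :&: H1 g P| == 0%N); congr measurable;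
      apply/seteqP; split => y /= /eqP.
  + by move=> y /= ->; rewrite finset.set0I cards0.
have [->|t0] := eqVneq t 0.
  by rewrite !mulr0 oppr0 expR0 subrr measure_ge0.
have {tP} [/andP[tgt0 t12] gap] := tP t0.
have g0 := density0_gt0 gd.
have a01 : 0 < alpha < 1 / 2 by rewrite a0.
have t01 : 0 < t <= alpha / 12 by rewrite tgt0.
have [s Gs Gsc] := quantile_gap_le gd a01 t01 gap.
pose T := n%:R * t / alpha.
have T0 : 0 < T by rewrite /T divr_gt0// mulr_gt0.
pose q := (12 * t / alpha - t / 2) / delta.
have qnu : q <= fine (nu0 (small_pvalue g t)).
  apply: le_trans (small_pvalue_tail gd nu0 (_ : 2 * Gbar g s <= t)); last first.
    by rewrite Gs; lra.
  rewrite /q ler_pdivrMr// [leRHS]mulrC.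
  apply: le_trans (confusable_tail gd conf s (ltW d0)).
  rewrite Gs lerD2r; apply: (le_trans Gsc); apply: (Gbar_nonincreasing gd).
  rewrite lerD2l lerN2.
  have -> : k%:R / (n%:R * (4 * g 0)) = delta / g 0.
    by rewrite /delta /label_excess; field; rewrite !gt_eqF.
  by rewrite ler_pdivrMr// mulrC.
have eT : 2 * n%:R * t / alpha = n%:R * t / (alpha / 2).
  by field; rewrite gt_eqF.
rewrite eT; apply: (BH_rejects_below gd _ _ locE H1E).
- by apply/andP; split; lra.
- by apply/andP; split; lra.
apply: le_trans (power_tail gd _ PE qnu).
rewrite lee_fin lerD2l lerN2 ler_expR -eT.
have -> : 2 * n%:R * t / alpha = 2 * T by rewrite /T !mulrA.
have -> : 20^-1 * alpha^-1 * n%:R * t = T / 20 by rewrite /T; ring.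
(* [16 / 45] is [2 / 5], the fraction of the expected number of labels that is
   kept, times [8 / 9], a lower bound on [1 / (1 + delta)]; and
   [12 - 1 / 4 = 47 / 4] because [t / 2 <= t / (4 * alpha)].  Their product
   exceeds 4, with room for the constant [1 / 20] of the exponent. *)
suff : (16 / 45) * (47 / 4) * T <= #|z|%:R * q by lra.
have tq : (47 / 4) * (T / n%:R) <= 12 * t / alpha - t / 2.
  have -> : T / n%:R = t / alpha by rewrite /T; field; rewrite !gt_eqF.
  have : t / 2 <= (t / alpha) / 4.
    rewrite -mulrA ler_pM2l// -invfM lef_pV2 ?posrE ?mulr_gt0//; lra.
  by rewrite -[12 * t / alpha]mulrA; lra.
have zl : (16 / 45) * (n%:R * delta) <= #|z|%:R by apply: le_trans zlow; lra.
apply: (@le_trans _ _ ((16 / 45) * (n%:R * delta) * q)); last first.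
  apply: ler_wpM2r => //; rewrite /q divr_ge0 ?(ltW d0)//.
  by apply: le_trans tq; rewrite mulr_ge0// divr_ge0 ?ltW.
have -> : (16 / 45) * (n%:R * delta) * q =
    (16 / 45) * (n%:R * (12 * t / alpha - t / 2)).
  by rewrite /q; field; rewrite !gt_eqF.
rewrite -mulrA ler_pM2l; last by lra.
apply: (@le_trans _ _ (n%:R * ((47 / 4) * (T / n%:R)))).
  by rewrite le_eqVlt; apply/orP; left; apply/eqP; field; rewrite gt_eqF.
by rewrite ler_pM2l.
Qed.

End LeastFavorable.

Unset Implicit Arguments.

Theorem theorem5p1 (R : realType) :
  exists c1 c2 : R, 0 < c1 /\ 0 < c2 /\
  forall g : R -> R, sym_unimodal_density g ->
  exists cg : R, 0 < cg /\
  forall (n k : nat) (alpha : R),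
    (2 * k < n)%N -> c1 <= (2 * k)%:R -> 0 < alpha -> alpha < 1 / 2 ->
    (set_minimum [set quantile_gap g alpha t | t in t_range n alpha]
      <= (k%:R / (n%:R * cg))%:E)%E ->
  forall t0 : R,
    t0 = set_maximum [set t | t_range n alpha t /\
           (quantile_gap g alpha t <= (k%:R / (n%:R * cg))%:E)%E] ->
  forall rej : n.-tuple (measurableTypeR R) -> {set 'I_n},
    testing_procedure rej ->
    ((forall P : probability (n.-tuple (measurableTypeR R)) R,
        model_le g k P -> (FDR g P rej <= (1 / 5)%:E)%E) ->
     exists P : probability (n.-tuple (measurableTypeR R)) R,
       [/\ model_le g k P,
           ((2 / 5)%:E <= P [set y | #|rej y :&: H1 g P| = 0%N])%E &
           ((1 - expR (- (c2 * alpha^-1 * n%:R * t0)))%:E <=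
             P [set y | (2 * n%:R * t0 / alpha <=
                         #|oracle_BH g P (alpha / 2) y :&: H1 g P|%:R)%R])%E])
    /\
    ((risk_I g rej k <= (1 / 5)%:E)%E ->
     ((2 / 5 - expR (- (c2 * alpha^-1 * n%:R * t0)))%:E <=
       risk_II g rej k (alpha / 2))%E).
Proof.
exists 10000, 20^-1; split; first by lra.
split; first by lra.
move=> g gd; exists (4 * g 0); split; first by rewrite mulr_gt0// density0_gt0.
move=> n k alpha kn c1k a0 a1 _ t0 t0E rej mrej.
have k_large : (5000 <= k)%N.
  by move: c1k; rewrite -(ler_nat R) natrM; lra.
have a01 : 0 < alpha < 1 / 2 by rewrite a0.
have t0P : t0 != 0 -> 0 < t0 <= alpha / 12 /\
    (quantile_gap g alpha t0 <= (k%:R / (n%:R * (4 * g 0)))%:E)%E.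
  rewrite t0E /set_maximum; case: xgetP => [t -> [[trange gap] _] _|_]; last first.
    by rewrite eqxx.
  split=> //; move: trange; rewrite /t_range /= in_itv /= => /andP[tlow ->].
  rewrite andbT; apply: lt_le_trans tlow; rewrite divr_gt0// mulr_gt0//.
  exact: sample_size_gt0 kn.
have lf fdr := least_favorable gd kn k_large a01 t0P mrej fdr.
split.
  by move=> /lf[P [mP Pnull Ppow]]; exists P.
move=> riskI.
have [|P [mP Pnull Ppow]] := lf.
  move=> P mP; apply: le_trans riskI.
  by apply: ereal_sup_ubound; exists P.
have inrisk : (P [set y | (TDP g P (rej y) < TDP g P (oracle_BH g P (alpha / 2) y))%R]
    <= risk_II g rej k (alpha / 2))%E.
  by apply: ereal_sup_ubound; exists P.
apply: le_trans inrisk.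
have [t00|t00] := eqVneq t0 0.
  rewrite t00 mulr0 oppr0 expR0; apply: (le_trans _ (measure_ge0 _ _)).
  by rewrite lee_fin; lra.
have [/andP[t0_gt0 _] _] := t0P t00.
have n0 := sample_size_gt0 R kn.
pose V y := (rej y, oracle_BH g P (alpha / 2) y).
have a2 : 0 < alpha / 2 <= 1 by apply/andP; split; lra.
have mV v : measurable (V @^-1` [set v]).
  have -> : V @^-1` [set v] = rej @^-1` [set v.1] `&`
      [set y | oracle_BH g P (alpha / 2) y = v.2].
    apply/seteqP; split => y /=; first by move=> <-.
    by case: v => v1 v2 /= [<- <-].
  by apply: measurableI; [exact: mrej|exact: measurable_BH].
have mE1 : measurable [set y | #|rej y :&: H1 g P| = 0%N].
  rewrite (_ : mkset _ = [set y | #|(V y).1 :&: H1 g P| == 0%N]).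
    exact: (measurable_finite mV (fun v => #|v.1 :&: H1 g P| == 0%N)).
  by apply/seteqP; split => y /= /eqP.
set E1 := [set y | _ = 0%N] in Pnull mE1.
pose E2 := [set y | 2 * n%:R * t0 / alpha <= #|(V y).2 :&: H1 g P|%:R].
have mE2 : measurable E2.
  exact: (measurable_finite mV (fun v => 2 * n%:R * t0 / alpha <= #|v.2 :&: H1 g P|%:R)).
have mTDP : measurable
    [set y | TDP g P (rej y) < TDP g P (oracle_BH g P (alpha / 2) y)].
  exact: (measurable_finite mV (fun v => TDP g P v.1 < TDP g P v.2)).
have E12 : E1 `&` E2 `<=`
    [set y | TDP g P (rej y) < TDP g P (oracle_BH g P (alpha / 2) y)].
  move=> y [/= E1y E2y]; rewrite /TDP E1y mul0r.
  rewrite divr_gt0 ?ltr0n ?leq_max ?orbT// -(ltr0n R).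
  by apply: lt_le_trans E2y; rewrite divr_gt0// !mulr_gt0.
apply: (@le_trans _ _ (P (E1 `&` E2))); last first.
  by apply: le_measure; rewrite ?inE//; exact: measurableI.
have PE1 : (P E1 <= P (E1 `&` E2) + P (~` E2))%E.
  apply: (@le_trans _ _ (P ((E1 `&` E2) `|` ~` E2))).
    apply: le_measure; rewrite ?inE//.
      by apply: measurableU; [exact: measurableI|exact: measurableC].
    by move=> y E1y; have [E2y|] := pselect (E2 y); [left|right].
  by apply: measureU2; [exact: measurableI|exact: measurableC].
have fin12 : P (E1 `&` E2) \is a fin_num.
  by rewrite fin_num_measure//; exact: measurableI.
have := le_trans Pnull PE1; move: Ppow; rewrite probability_setC// -/E2.
rewrite -(fineK fin12) -[P E2]fineK ?fin_num_measure// -EFinB -EFinD !lee_fin.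
by lra.
Qed.
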